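(* Let $A,C\in\mathbb{R}^{n\times n}$ and $B,D\in\mathbb{R}^{n\times m}$. The system $$dx(t)=(Ax(t)+Bu(t))\,dt+(Cx(t)+Du(t))\,dw(t),\quad x(0)=x_0\in\mathbb{R}^n,$$ is weakly stabilizable if one of the following conditions holds: 1) There exist $K\in\mathbb{R}^{m\times n}$ and $P>0$ such that $P(A+BK)+(A+BK)'P+(C+DK)'P(C+DK)\le0$. 2) There exist $K\in\mathbb{R}^{m\times n}$ and $P>0$ such that $(A+BK)P+P(A+BK)'+(C+DK)P(C+DK)'\le0$. 3) There exist matrices $P$ and $Y$ such that the following linear matrix inequality holds: $$\begin{bmatrix}AP+PA'+BY+Y'B' & CP+DY\\ PC'+Y'D' & -P\end{bmatrix}\le0.$$
   Context: $w$ is a standard one-dimensional Wiener process with $w(0)=0$. $M'$ denotes the transpose of $M$; $P>0$ means that the $n\times n$ matrix $P$ is symmetric positive definite, and $M\le0$ means that $M$ is symmetric negative semidefinite. In 3), $P$ is $n\times n$ and $Y$ is $m\times n$. The system is weakly stabilizable if there exists $K\in\mathbb{R}^{m\times n}$ such that the closed-loop system $dx=(A+BK)x\,dt+(C+DK)x\,dw$, $x(0)=x_0$, obtained with the state feedback $u(t)=Kx(t)$, is two-stable, i.e. for each $\varepsilon>0$ there exists $\delta>0$ such that its solution $x(t,x_0)$ satisfies $E|x(t,x_0)|^2<\varepsilon$ whenever $t\ge0$ and $|x_0|<\delta$.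
   Formalization: In condition 3) the matrix P is required to be symmetric positive definite (P>0), as in 1) and 2); without this, P=0, Y=0 satisfies the inequality for every system and the claim fails, e.g. for A=1, B=C=D=0. *)

(* Defs.v *)
From HB Require Import structures.
From mathcomp Require Import all_boot all_order all_algebra.
From mathcomp Require Import all_classical all_reals all_analysis.

Set Implicit Arguments.
Unset Strict Implicit.
Unset Printing Implicit Defensive.

Import Order.TTheory GRing.Theory Num.Theory.
Import numFieldNormedType.Exports.

Local Open Scope classical_set_scope.
Local Open Scope ring_scope.

Definition posdef (R : realType) (n : nat) (M : 'M[R]_n) : Prop :=
  M^T = M /\ forall v : 'cV[R]_n, v != 0 -> 0 < (v^T *m M *m v) 0 0.

Definition negsemidef (R : realType) (n : nat) (M : 'M[R]_n) : Prop :=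
  M^T = M /\ forall v : 'cV[R]_n, (v^T *m M *m v) 0 0 <= 0.

(* The Euclidean norm; the library's norm on matrices is the sup norm. *)
Definition enorm (R : realType) (n : nat) (v : 'cV[R]_n) : R :=
  Num.sqrt (\sum_(i < n) v i 0 ^+ 2).

(* Processes are indexed by all of R; only the times t >= 0 matter. *)

Definition measurable_wrt (R : realType) (T : Type) (G : set (set T))
    (X : T -> R) : Prop :=
  forall B : set R, measurable B -> G (X @^-1` B).

Record filtration (R : realType) (d : measure_display) (T : measurableType d)
    (P : probability T R) (F : R -> set (set T)) : Prop := Filtration {
  filtration_sigma_algebra : forall t : R, 0 <= t -> sigma_algebra setT (F t) ;
  filtration_sub : forall t : R, 0 <= t -> F t `<=` measurable ;
  filtration_le : forall s t : R, 0 <= s -> s <= t -> F s `<=` F t ;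
  filtration_null : forall (t : R) N, 0 <= t -> measurable N -> P N = 0%E ->
    F t N }.

(* The second argument of normal_prob is the standard deviation. *)
Record wiener (R : realType) (d : measure_display) (T : measurableType d)
    (P : probability T R) (F : R -> set (set T)) (w : R -> T -> R) : Prop :=
  Wiener {
  wiener_adapted : forall t : R, 0 <= t -> measurable_wrt (F t) (w t) ;
  wiener0 : {ae P, forall o, w 0 o = 0} ;
  wiener_continuous :
    {ae P, forall o, {within `[0, +oo[, continuous (fun t : R => w t o)}} ;
  wiener_normal : forall (s t : R) (B : set R), 0 <= s -> s < t ->
    measurable B ->
    P ((fun o => w t o - w s o) @^-1` B) = normal_prob 0 (Num.sqrt (t - s)) B ;
  wiener_independent : forall (s t : R) A (B : set R), 0 <= s -> s < t ->
    F s A -> measurable B ->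
    P (A `&` (fun o => w t o - w s o) @^-1` B) =
      (P A * P ((fun o => (w t o - w s o)%R) @^-1` B))%E }.

(* The class of integrands of the Ito integral over [0, t]: jointly measurable,
   adapted, square integrable. *)
Record ito_integrand (R : realType) (d : measure_display)
    (T : measurableType d) (P : probability T R) (F : R -> set (set T)) (t : R)
    (X : R -> T -> R) : Prop := ItoIntegrand {
  ito_integrand_measurable :
    measurable_fun (`[0, t] `*` setT)
      (fun p : measurableTypeR R * T => X p.1 p.2) ;
  ito_integrand_adapted :
    forall s : R, 0 <= s -> s <= t -> measurable_wrt (F s) (X s) ;
  ito_integrand_L2 :
    (\int[P]_o \int[lebesgue_measure]_(s in `[0%R, t]) (X s o ^+ 2)%:E
      < +oo)%E }.

(* Only the indices i < esize of ecoef and i <= esize of etime matter. *)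
Record elementary (R : realType) (T : Type) := Elementary {
  esize : nat ;
  etime : nat -> R ;
  ecoef : nat -> T -> R }.

Definition elementary_on (R : realType) (T : Type) (F : R -> set (set T))
    (t : R) (f : elementary R T) : Prop :=
  [/\ 0 <= etime f 0,
      forall i, (i < esize f)%N -> etime f i <= etime f i.+1,
      etime f (esize f) <= t &
      forall i, (i < esize f)%N ->
        measurable_wrt (F (etime f i)) (ecoef f i) /\
        exists M : R, forall o, `|ecoef f i o| <= M].

Definition elementary_process (R : realType) (T : Type) (f : elementary R T)
    (s : R) (o : T) : R :=
  \sum_(i < esize f) ecoef f i o * \1_(`[etime f i, etime f i.+1[) s.

Definition elementary_integral (R : realType) (T : Type) (w : R -> T -> R)
    (f : elementary R T) (o : T) : R :=
  \sum_(i < esize f) ecoef f i o * (w (etime f i.+1) o - w (etime f i) o).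

(* I is a version of the Ito integral of X over [0, t]: the L^2(P) limit of the
   integrals of elementary processes converging to X in L^2([0, t] x T). *)
Definition ito_integral (R : realType) (d : measure_display)
    (T : measurableType d) (P : probability T R) (F : R -> set (set T))
    (w : R -> T -> R) (t : R) (X : R -> T -> R) (I : T -> R) : Prop :=
  [/\ ito_integrand P F t X, measurable_fun setT I &
    exists f : nat -> elementary R T,
      [/\ forall k, elementary_on F t (f k),
          (\int[P]_o \int[lebesgue_measure]_(s in `[0%R, t])
             ((elementary_process (f k) s o - X s o) ^+ 2)%:E)%E
             @[k --> \oo] --> 0%E &
          (\int[P]_o ((elementary_integral w (f k) o - I o) ^+ 2)%:E)%E
             @[k --> \oo] --> 0%E]].

(* x solves dx = M x dt + N x dw, x(0) = x0, i.e. almost surely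
   x(t) = x0 + \int_0^t M x ds + \int_0^t N x dw for each t >= 0. *)
Record sde_solution (R : realType) (d : measure_display) (T : measurableType d)
    (P : probability T R) (F : R -> set (set T)) (w : R -> T -> R) (n : nat)
    (M N : 'M[R]_n) (x0 : 'cV[R]_n) (x : R -> T -> 'cV[R]_n) : Prop :=
  SdeSolution {
  sde_continuous : {ae P, forall o, forall i : 'I_n,
    {within `[0, +oo[, continuous (fun t : R => x t o i 0)}} ;
  sde_integrand : forall (t : R) (i : 'I_n), 0 <= t ->
    ito_integrand P F t (fun s o => x s o i 0) ;
  sde_equation : forall (t : R) (i : 'I_n), 0 <= t ->
    exists2 I : T -> R,
      ito_integral P F w t (fun s o => (N *m x s o) i 0) I &
      {ae P, forall o, x t o i 0 =
        x0 i 0 + \int[lebesgue_measure]_(s in `[0, t]) (M *m x s o) i 0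
        + I o} }.

Definition two_stable (R : realType) (d : measure_display)
    (T : measurableType d) (P : probability T R) (F : R -> set (set T))
    (w : R -> T -> R) (n : nat) (M N : 'M[R]_n) : Prop :=
  forall eps : R, 0 < eps -> exists2 delta : R, 0 < delta &
    forall (x0 : 'cV[R]_n) (x : R -> T -> 'cV[R]_n),
      sde_solution P F w M N x0 x ->
      forall t : R, 0 <= t -> enorm x0 < delta ->
        ('E_P[fun o => (enorm (x t o) ^+ 2)%R] < eps%:E)%E.

Definition weakly_stabilizable (R : realType) (d : measure_display)
    (T : measurableType d) (P : probability T R) (F : R -> set (set T))
    (w : R -> T -> R) (n m : nat) (A : 'M[R]_n) (B : 'M[R]_(n, m))
    (C : 'M[R]_n) (D : 'M[R]_(n, m)) : Prop :=
  exists K : 'M[R]_(m, n), two_stable P F w (A + B *m K) (C + D *m K).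

(* Main.v *)
Require Import Defs.
From HB Require Import structures.
From mathcomp Require Import all_boot all_order all_algebra.
From mathcomp Require Import all_classical all_reals all_analysis.
From mathcomp Require Import measurable_realfun ring lra.

Set Implicit Arguments.
Unset Strict Implicit.
Unset Printing Implicit Defensive.

Import Order.TTheory GRing.Theory Num.Theory.
Import numFieldNormedType.Exports.

Local Open Scope classical_set_scope.
Local Open Scope ring_scope.

(** With u = K x the closed loop is the linear equation dx = M x dt + N x dw,
    where M = A + B K and N = C + D K, and E|x(t)|^2 is the trace of the second
    moment matrix S(t) = E[x(t) x(t)'].  Formally Ito's formula gives
    S' = M S + S M' + N S N'.  The proof replaces this differential equation by
    a one-step estimate ([moment_step]): uniformly for t in a bounded interval,
      S(t + h) = S(t) + h (M S(t) + S(t) M' + N S(t) N') + O(h sqrt h).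
    A bound that every Euler step preserves up to an error O(h sqrt h) holds in
    the limit, because t / h steps accumulate an error O(sqrt h) only
    ([euler_gronwall]).

    Condition 1 says that tr(Q S) has a nonpositive Euler increment, as
    tr(Q (M S + S M' + N S N')) = tr((Q M + M' Q + N' Q N) S) and S >= 0; so
    tr(Q S(t)) stays below x0' Q x0 ([lyapunov_bound]).  Condition 2 says that
    the bound S <= c Q is preserved: up to the term - h^2 M S M', which is
    nonpositive, the Euler step S + h (M S + S M' + N S N') equals
    (1 + h M) S (1 + h M)' + h N S N', which is monotone in S, and its value at
    c Q is at most c Q + O(h^2) ([dual_lyapunov_bound]).  In both cases the
    trace of S(t) is at most a constant times |x0|^2, and two-stability follows.
    Condition 3 is condition 2 for K = Y Q^-1, by a Schur complement
    ([schur_generator]).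

    The one-step estimate comes from an Euler-Maruyama expansion
    ([euler_step]): x(t + h) = x(t) + A + J, where A = h M x(t) + O(h^(3/2)) and
    J = N x(t) (w(t + h) - w(t)) + O(h) in mean square.  The error O(h) of J
    would be too large against x(t); but J is orthogonal to all square-integrable
    F_t-measurable variables, so that this error meets only J, of order sqrt h,
    and smaller terms.  These properties of J use the Ito integral
    only through the isometry for simple processes ([ito_isometry_simple]),
    which passes to limits as a bound ([ito_lim_bound]) and as an orthogonality
    ([ito_lim_orth]).  The isometry in turn rests on the conditional moments of
    the increments of w given the past, that is, on independence
    ([integral_independent]) and on the first two moments of the normal law. *)

(** * Square-integrable functions *)

Section SquareIntegrable.
Context {R : realType} {d : measure_display} {X : measurableType d}.
Variable mu : {measure set X -> \bar R}.
Implicit Types f g h : X -> R.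

Definition sqint f : Prop :=
  measurable_fun setT f /\ mu.-integrable setT (EFin \o (fun x => f x ^+ 2)).

(** The semi-inner product of L^2 on actual functions: working without classes
    modulo null sets keeps processes and their values at fixed times. *)
Definition ip f g : R := \int[mu]_x (f x * g x).

Lemma measurable_integrable f :
  mu.-integrable setT (EFin \o f) -> measurable_fun setT f.
Proof. by move=> /measurable_int /measurable_EFinP. Qed.

Lemma integrable_le f g : measurable_fun setT f ->
  (forall x, `|f x| <= `|g x|) -> mu.-integrable setT (EFin \o g) ->
  mu.-integrable setT (EFin \o f).
Proof.
move=> mf fg; apply: le_integrable => //.
  exact/measurable_EFinP.
by move=> x _; rewrite /= lee_fin.
Qed.

Lemma integrable_fD f g : mu.-integrable setT (EFin \o f) ->
  mu.-integrable setT (EFin \o g) ->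
  mu.-integrable setT (EFin \o (fun x => f x + g x)).
Proof.
by move=> If Ig; have := integrableD measurableT If Ig; apply: eq_integrable.
Qed.

Lemma integrable_fZ a f : mu.-integrable setT (EFin \o f) ->
  mu.-integrable setT (EFin \o (fun x => a * f x)).
Proof.
by move=> If; have := integrableZl measurableT a If; apply: eq_integrable.
Qed.

Lemma integrable_mul f g : sqint f -> sqint g ->
  mu.-integrable setT (EFin \o (fun x => f x * g x)).
Proof.
move=> [mf If] [mg Ig].
apply: (integrable_le _ _ (integrable_fD If Ig)).
  exact: measurable_funM.
move=> x; rewrite normrM [leRHS]ger0_norm; last by rewrite addr_ge0 ?sqr_ge0.
rewrite -(real_normK (num_real (f x))) -(real_normK (num_real (g x))).
by have := normr_ge0 (f x); have := normr_ge0 (g x); nra.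
Qed.

Lemma sqintD f g : sqint f -> sqint g -> sqint (fun x => f x + g x).
Proof.
move=> sf sg; have [mf If] := sf; have [mg Ig] := sg.
split; first exact: measurable_funD.
have := integrable_fD (integrable_fD If Ig)
                      (integrable_fZ 2 (integrable_mul sf sg)).
by apply: eq_integrable => // x _; rewrite /=; congr EFin; ring.
Qed.

Lemma sqintZ a f : sqint f -> sqint (fun x => a * f x).
Proof.
move=> [mf If]; split; first exact: measurable_funM.
have := integrable_fZ (a ^+ 2) If.
by apply: eq_integrable => // x _; rewrite /= exprMn.
Qed.

Lemma eq_sqint f g : f =1 g -> sqint f -> sqint g.
Proof. by move=> /funext ->. Qed.

Lemma sqintB f g : sqint f -> sqint g -> sqint (fun x => f x - g x).
Proof.
move=> sf sg; apply: eq_sqint (sqintD sf (sqintZ (-1) sg)) => x.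
by rewrite mulN1r.
Qed.

Lemma sqint0 : sqint (fun=> 0).
Proof.
split; first exact: measurable_cst.
have := integrable0 mu [set: X].
by apply: eq_integrable => // x _; rewrite /= expr0n.
Qed.

Lemma sqint_sum (I : Type) (s : seq I) (F : I -> X -> R) :
  (forall i, sqint (F i)) -> sqint (fun x => \sum_(i <- s) F i x).
Proof.
move=> sF; elim: s => [|i s IH].
  by apply: eq_sqint sqint0 => x; rewrite big_nil.
by apply: eq_sqint (sqintD (sF i) IH) => x; rewrite big_cons.
Qed.

Lemma eq_ip f f' g g' : f =1 f' -> g =1 g' -> ip f g = ip f' g'.
Proof. by move=> /funext -> /funext ->. Qed.

Lemma ipC f g : ip f g = ip g f.
Proof. by rewrite /ip; apply: eq_Rintegral => x _; rewrite mulrC. Qed.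

Lemma ipDl f g h : sqint f -> sqint g -> sqint h ->
  ip (fun x => f x + g x) h = ip f h + ip g h.
Proof.
move=> sf sg sh; rewrite /ip -RintegralD //; try exact: integrable_mul.
by apply: eq_Rintegral => x _; rewrite mulrDl.
Qed.

Lemma ipZl a f g : sqint f -> sqint g -> ip (fun x => a * f x) g = a * ip f g.
Proof.
move=> sf sg; rewrite /ip -RintegralZl //; last exact: integrable_mul.
by apply: eq_Rintegral => x _; rewrite mulrA.
Qed.

Lemma ipDr f g h : sqint f -> sqint g -> sqint h ->
  ip h (fun x => f x + g x) = ip h f + ip h g.
Proof. by move=> sf sg sh; rewrite ipC ipDl // !(ipC h). Qed.

Lemma ipZr a f g : sqint f -> sqint g -> ip g (fun x => a * f x) = a * ip g f.
Proof. by move=> sf sg; rewrite ipC ipZl // ipC. Qed.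

Lemma ip0l g : ip (fun=> 0) g = 0.
Proof.
rewrite /ip; under eq_Rintegral do rewrite mul0r.
by rewrite Rintegral_cst ?mul0r.
Qed.

Lemma ip_suml (I : Type) (s : seq I) (F : I -> X -> R) g :
  (forall i, sqint (F i)) -> sqint g ->
  ip (fun x => \sum_(i <- s) F i x) g = \sum_(i <- s) ip (F i) g.
Proof.
move=> sF sg; elim: s => [|i s IH].
  rewrite big_nil -[RHS](ip0l g); apply: eq_ip => // x; by rewrite big_nil.
rewrite big_cons -IH -ipDl //; last exact: sqint_sum.
by apply: eq_ip => // x; rewrite big_cons.
Qed.

Lemma ip_ge0 f : 0 <= ip f f.
Proof. by apply: Rintegral_ge0 => x _; rewrite -expr2 sqr_ge0. Qed.

Lemma ipE f : sqint f -> (ip f f)%:E = (\int[mu]_x (f x ^+ 2)%:E)%E.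
Proof.
move=> [_ If]; rewrite /ip /Rintegral fineK; last first.
  by have := integrable_fin_num measurableT If; apply.
by [].
Qed.

Lemma sqint_lty f : measurable_fun setT f ->
  (\int[mu]_x (f x ^+ 2)%:E < +oo)%E -> sqint f.
Proof.
move=> mf fy; split => //; apply/integrableP; split.
  exact/measurable_EFinP/measurable_funX.
by under eq_integral => x _ do rewrite /= ger0_norm ?sqr_ge0 //.
Qed.

Lemma ip_le f a : measurable_fun setT f ->
  (\int[mu]_x (f x ^+ 2)%:E <= a%:E)%E -> sqint f /\ ip f f <= a.
Proof.
move=> mf fa; have sf : sqint f by apply: sqint_lty => //; exact: le_lt_trans (ltry a).
by split => //; rewrite -lee_fin ipE.
Qed.

(** The free weight e lets two factors of different orders of magnitude be
    balanced against each other. *)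
Lemma ip_young (e : R) f g : 0 < e -> sqint f -> sqint g ->
  2 * `|ip f g| <= e * ip f f + e^-1 * ip g g.
Proof.
move=> e0 sf sg.
have Ifg := integrable_mul sf sg.
have If : mu.-integrable setT (EFin \o (fun x => e * (f x * f x))).
  exact/integrable_fZ/integrable_mul.
have Ig : mu.-integrable setT (EFin \o (fun x => e^-1 * (g x * g x))).
  exact/integrable_fZ/integrable_mul.
have := le_normr_Rintegral measurableT Ifg.
rewrite -(ler_pM2l (ltr0Sn R 1)) => /le_trans; apply.
rewrite /ip -!RintegralZl //; try exact: integrable_mul; last first.
  exact: integrable_norm.
rewrite -RintegralD //; apply: le_Rintegral => //.
- exact/integrable_fZ/integrable_norm.
- exact: integrable_fD.
move=> x _; rewrite normrM -!expr2.
rewrite -(real_normK (num_real (f x))) -(real_normK (num_real (g x))).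
move: (normr_ge0 (f x)) (normr_ge0 (g x)).
move: `|f x| `|g x| => a b a0 b0.
have -> : e * a ^+ 2 + e^-1 * b ^+ 2 = e^-1 * ((e * a) ^+ 2 + b ^+ 2).
  by field; rewrite gt_eqF.
have -> : 2 * (a * b) = e^-1 * (2 * (e * a) * b) by field; rewrite gt_eqF.
rewrite ler_pM2l ?invr_gt0 //.
by have := sqr_ge0 (e * a - b); rewrite -subr_ge0; lra.
Qed.

Lemma ip_sqrD f g : sqint f -> sqint g ->
  ip (fun x => f x + g x) (fun x => f x + g x) <= 2 * ip f f + 2 * ip g g.
Proof.
move=> sf sg; have sD := sqintD sf sg.
rewrite ipDl // !ipDr // (ipC g f).
have := ip_young ltr01 sf sg; rewrite invr1 !mul1r.
by have := ler_norm (ip f g); lra.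
Qed.

Lemma ip_sqr_trans f g h : sqint f -> sqint g -> sqint h ->
  ip (fun x => f x - h x) (fun x => f x - h x) <=
  2 * ip (fun x => f x - g x) (fun x => f x - g x) +
  2 * ip (fun x => g x - h x) (fun x => g x - h x).
Proof.
move=> sf sg sh; have := ip_sqrD (sqintB sf sg) (sqintB sg sh).
by rewrite (_ : (fun x => f x - g x + (g x - h x)) = (fun x => f x - h x)) //;
  apply/funext => x; rewrite addrA subrK.
Qed.

Lemma ip_ae f f' g : measurable_fun setT f -> measurable_fun setT f' ->
  measurable_fun setT g -> {ae mu, forall x, f x = f' x} ->
  ip f g = ip f' g.
Proof.
move=> mf mf' mg ff'; rewrite /ip /Rintegral; congr fine.
apply: ae_eq_integral => //.
- exact/measurable_EFinP/measurable_funM.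
- exact/measurable_EFinP/measurable_funM.
- by apply: filterS ff' => x /= -> _.
Qed.

Lemma ip_le_norm f g : sqint f -> sqint g ->
  (forall x, `|f x| <= `|g x|) -> ip f f <= ip g g.
Proof.
move=> sf sg fg; apply: le_Rintegral => //; try exact: integrable_mul.
move=> x _; rewrite -!expr2.
rewrite -(real_normK (num_real (f x))) -(real_normK (num_real (g x))).
by rewrite lerXn2r ?nnegrE.
Qed.

Lemma ip_sqr_sym f g : sqint f -> sqint g ->
  ip (fun x => f x - g x) (fun x => f x - g x) =
  ip (fun x => g x - f x) (fun x => g x - f x).
Proof. by move=> sf sg; apply: eq_Rintegral => x _; ring. Qed.

Lemma ip_le_trans f g a b : sqint f -> sqint g ->
  ip (fun x => f x - g x) (fun x => f x - g x) <= a ->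
  ip g g <= b -> ip f f <= 2 * a + 2 * b.
Proof.
move=> sf sg fa gb.
have := ip_sqrD (sqintB sf sg) sg.
have -> : (fun x => f x - g x + g x) = f by apply/funext => x; rewrite subrK.
by lra.
Qed.

Lemma ip_cauchy_schwarz f g : sqint f -> sqint g ->
  (ip f g) ^+ 2 <= ip f f * ip g g.
Proof.
move=> sf sg; set y := ip f g; set a := ip f f; set b := ip g g.
have young e : 0 < e -> 2 * `|y| <= e * a + e^-1 * b.
  by move=> e0; exact: ip_young.
have a0 : 0 <= a by exact: ip_ge0.
have b0 : 0 <= b by exact: ip_ge0.
have [->|y0] := eqVneq y 0; first by rewrite expr0n mulr_ge0.
have ny : 0 < `|y| by rewrite normr_gt0.
rewrite -(real_normK (num_real y)).
have [a00|a00] := eqVneq a 0.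
  (* f is null: a large weight on its vanishing norm leaves only a small multiple
   of the norm of g. *)
  have e0 : 0 < (b + 1) / `|y| by rewrite divr_gt0 // ltr_wpDl.
  have := young _ e0; rewrite a00 mulr0 add0r invf_div mulrAC.
  have : `|y| * b / (b + 1) <= `|y|.
    rewrite ler_pdivrMr ?ltr_wpDl // ler_pM2l //; lra.
  by move=> h1 h2; exfalso; move: h1 h2; rewrite -/b; lra.
have ap : 0 < a by rewrite lt_def a00.
have e0 : 0 < `|y| / a by rewrite divr_gt0.
have := young _ e0; rewrite divfK // invf_div => h.
have {}h : `|y| <= a / `|y| * b by lra.
have := h; by rewrite mulrAC ler_pdivlMr.
Qed.

(** Here r stands for the square root of the length of an Euler step: factors of
    size r^p and r^q have a product of order r^(p + q), and r^3 is the error that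
    a step may make. *)
Lemma ip_power_bound (C r : R) p q f g : 0 <= C -> 0 <= r -> r <= 1 ->
  (3 <= p + q)%N -> sqint f -> sqint g ->
  ip f f <= C * r ^+ p ^+ 2 -> ip g g <= C * r ^+ q ^+ 2 ->
  `|ip f g| <= C * r ^+ 3.
Proof.
move=> C0 r0 r1 pq sf sg fp gq.
have rp : 0 <= r ^+ p by rewrite exprn_ge0.
have rq : 0 <= r ^+ q by rewrite exprn_ge0.
apply: (@le_trans _ _ (C * (r ^+ p * r ^+ q))); last first.
  by rewrite ler_wpM2l // -exprD ler_wiXn2l.
rewrite -(@ler_pXn2r _ 2) ?nnegrE ?mulr_ge0 // real_normK ?num_real //.
apply: (le_trans (ip_cauchy_schwarz sf sg)).
have -> : (C * (r ^+ p * r ^+ q)) ^+ 2 = (C * r ^+ p ^+ 2) * (C * r ^+ q ^+ 2).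
  by ring.
by apply: ler_pM => //; exact: ip_ge0.
Qed.

Lemma sum_ip (I : Type) (s : seq I) (f g : I -> X -> R) :
  (forall i, sqint (f i)) -> (forall i, sqint (g i)) ->
  mu.-integrable setT (EFin \o (fun x => \sum_(i <- s) f i x * g i x)) /\
  \sum_(i <- s) ip (f i) (g i) = \int[mu]_x \sum_(i <- s) f i x * g i x.
Proof.
move=> sf sg; elim: s => [|i s [IH1 IH2]].
  under eq_fun do rewrite big_nil.
  rewrite big_nil; split; first exact: integrable0.
  by rewrite Rintegral_cst ?mul0r.
have Ii := integrable_mul (sf i) (sg i).
under eq_fun do rewrite big_cons.
split; first exact: integrable_fD.
by rewrite big_cons IH2 -RintegralD.
Qed.

End SquareIntegrable.

Lemma ip_lincomb_le (R : realType) d (X : measurableType d)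
    (mu : {measure set X -> \bar R}) n (c : 'I_n -> R) (f : 'I_n -> X -> R) K :
  0 <= K -> (forall i, sqint mu (f i)) -> (forall i, ip mu (f i) (f i) <= K) ->
  sqint mu (fun x => \sum_i c i * f i x) /\
  ip mu (fun x => \sum_i c i * f i x) (fun x => \sum_i c i * f i x) <=
    (\sum_i `|c i|) ^+ 2 * K.
Proof.
move=> K0 sf fK.
have scf i : sqint mu (fun x => c i * f i x) by exact: sqintZ.
have ss := sqint_sum (index_enum 'I_n) scf.
split => //; rewrite ip_suml // expr2 mulr_suml mulr_suml.
apply: ler_sum => i _; rewrite ipC ip_suml // mulr_sumr mulr_suml.
apply: ler_sum => j _; rewrite ipZl // ipZr // mulrA.
apply: (le_trans (ler_norm _)); rewrite normrM normrM [`|c j| * _]mulrC.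
rewrite ler_wpM2l ?mulr_ge0 //.
have := ip_young ltr01 (sf j) (sf i); rewrite invr1 !mul1r.
by have := fK i; have := fK j; lra.
Qed.

(** Estimates proved for each coordinate separately become uniform: the sum of
    the finitely many constants serves for all of them. *)
Lemma exists_uniform (R : realType) n (Q : 'I_n -> R -> Prop) :
  (forall i K K', K <= K' -> Q i K -> Q i K') ->
  (forall i, exists2 K, 0 <= K & Q i K) ->
  exists2 K, 0 <= K & forall i, Q i K.
Proof.
move=> mono ex.
have ex' i : exists K, 0 <= K /\ Q i K by have [K] := ex i; exists K.
have [f fQ] := fin_all_exists ex'.
exists (\sum_i f i); first by apply: sumr_ge0 => i _; case: (fQ i).
move=> i; case: (fQ i) => _; apply: mono; rewrite (bigD1 i) //= lerDl.
by apply: sumr_ge0 => j _; case: (fQ j).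
Qed.

(** * Moments of the centred Gaussian law *)

Section GaussianMoments.
Context {R : realType}.
Local Notation mu := (@lebesgue_measure R).
Implicit Types (s m r c : R) (g : R -> R).

Lemma ge0_integral_normal_prob s (f : R -> \bar R) :
  (forall x, 0 <= f x)%E -> measurable_fun setT f ->
  (\int[normal_prob 0%R s]_x f x = \int[mu]_x (f x * (normal_pdf 0 s x)%:E))%E.
Proof.
move=> f0 mf.
have dom := normal_prob_dominates 0 s.
rewrite -(Radon_Nikodym_SigmaFinite.change_of_variables dom) //.
apply: ae_eq_integral => //.
- apply: emeasurable_funM => //; apply: (measurable_int mu).
  exact: Radon_Nikodym_SigmaFinite.f_integrable.
- apply: emeasurable_funM => //; apply/measurable_EFinP.
  exact: measurable_normal_pdf.
- apply: ae_eqe_mul2l => /=.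
  apply: integral_ae_eq => //=.
  + exact: Radon_Nikodym_SigmaFinite.f_integrable.
  + by apply/measurable_EFinP; exact: measurable_normal_pdf.
  + by move=> E _ mE; rewrite -Radon_Nikodym_SigmaFinite.f_integral.
Qed.

(** Exponential moments of a normal law are integrals of another normal density
    up to a factor, hence known exactly; the first two moments are then extracted
    from exp y >= 1 + y. *)
Lemma integral_normal_prob_ratio s m r c g :
  (forall x, 0 <= g x) -> measurable_fun setT g -> 0 <= c ->
  (forall x, g x * normal_pdf 0 s x = c * normal_pdf m r x) ->
  (\int[normal_prob 0%R s]_x (g x)%:E = c%:E)%E.
Proof.
move=> g0 mg c0 gE.
rewrite ge0_integral_normal_prob //; last exact/measurable_EFinP.
under eq_integral do rewrite -EFinM gE EFinM.
rewrite ge0_integralZl_EFin //.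
- by rewrite integral_normal_pdf mule1.
- by move=> x _; rewrite lee_fin normal_pdf_ge0.
- by apply/measurable_EFinP; exact: measurable_normal_pdf.
Qed.

Lemma integral_normal_prob_expR_sqr s q : 0 < s -> 0 < q ->
  (\int[normal_prob 0%R s]_x
     (expR ((1 - q ^- 2) / (s ^+ 2 *+ 2) * x ^+ 2))%:E = q%:E)%E.
Proof.
move=> s0 q0; apply: (@integral_normal_prob_ratio _ 0 (s * q)).
- by move=> x; exact: expR_ge0.
- by apply: measurableT_comp => //; apply: measurable_funM => //.
- exact: ltW.
move=> x; have sq0 : 0 < s * q by rewrite mulr_gt0.
rewrite !normal_pdfE ?gt_eqF // /normal_peak /normal_fun !subr0.
have -> : Num.sqrt ((s * q) ^+ 2 * pi *+ 2) = q * Num.sqrt (s ^+ 2 * pi *+ 2).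
  have -> : (s * q) ^+ 2 * pi *+ 2 = q ^+ 2 * (s ^+ 2 * pi *+ 2).
    by rewrite !mulr2n; ring.
  by rewrite sqrtrM ?sqr_ge0 // sqrtr_sqr gtr0_norm.
rewrite [(q * Num.sqrt _)^-1]invfM -(mulrA q^-1) mulVKf ?gt_eqF //.
rewrite mulrCA -expRD; congr (_ * expR _).
by field; rewrite ?gt_eqF.
Qed.

Lemma integral_normal_prob_expR s m : 0 < s ->
  (\int[normal_prob 0%R s]_x
     (expR (m * x - m ^+ 2 * s ^+ 2 / 2))%:E = 1)%E.
Proof.
move=> s0; apply: (@integral_normal_prob_ratio _ (m * s ^+ 2) s).
- by move=> x; exact: expR_ge0.
- apply: measurableT_comp => //; apply: measurable_funB => //.
- exact: ler01.
move=> x; rewrite !normal_pdfE ?gt_eqF // /normal_fun !subr0 mul1r.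
rewrite mulrCA -expRD; congr (_ * expR _).
by field; rewrite ?gt_eqF.
Qed.

(** Let V be the second moment.  Integrating exp y >= 1 + y for a multiple y of
    x^2 gives (1 - q^-2) V / (2 s^2) <= q - 1 for every q > 0, with equality at
    q = 1; comparing the slopes there from both sides forces V = s^2. *)
Lemma normal_prob_second_moment s : 0 < s ->
  (normal_prob 0 s).-integrable setT (EFin \o (fun x : R => x ^+ 2)) /\
  \int[normal_prob 0 s]_x (x ^+ 2) = s ^+ 2.
Proof.
move=> s0; pose N := normal_prob 0 s.
have s2 : 0 < s ^+ 2 *+ 2 by rewrite mulrn_wgt0 ?exprn_gt0.
have msqr : measurable_fun setT (fun x : R => x ^+ 2) by exact: measurable_funX.
have Iexp q : 0 < q -> N.-integrable setT
    (EFin \o (fun x => expR ((1 - q ^- 2) / (s ^+ 2 *+ 2) * x ^+ 2))).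
  move=> q0; apply/integrableP; split.
    apply/measurable_EFinP; apply: measurableT_comp => //.
    exact: measurable_funM.
  under eq_integral => x _ do rewrite /= ger0_norm ?expR_ge0 //.
  by rewrite integral_normal_prob_expR_sqr ?ltry.
have I2 : N.-integrable setT (EFin \o (fun x : R => x ^+ 2)).
  (* q = 2 gives a positive exponent, and its exponential dominates x^2. *)
  pose a := (1 - 2 ^- 2) / (s ^+ 2 *+ 2).
  have a0 : 0 < a by rewrite divr_gt0 //; lra.
  have := integrable_fZ a^-1 (Iexp 2 (ltr0Sn _ 1)).
  apply: integrable_le => // x.
  rewrite ger0_norm ?sqr_ge0 // ger0_norm; last first.
    by rewrite mulr_ge0 ?expR_ge0 // invr_ge0 ltW.
  rewrite ler_pdivlMl //.
  by have := expR_ge1Dx (a * x ^+ 2); lra.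
split => //.
set M := \int[_]_x _.
have key q : 0 < q -> (1 - q ^- 2) / (s ^+ 2 *+ 2) * M <= q - 1.
  move=> q0; set a := _ / _.
  have I1 : N.-integrable setT (EFin \o (fun x : R => 1)).
    by apply: finite_measure_integrable_cst.
  have : \int[N]_x (1 + a * x ^+ 2) <= \int[N]_x expR (a * x ^+ 2).
    apply: le_Rintegral => //; last by move=> x _; exact: expR_ge1Dx.
    - exact/integrable_fD/integrable_fZ.
    - exact: Iexp.
  rewrite RintegralD //; last exact: integrable_fZ.
  rewrite RintegralZl // Rintegral_cst //.
  rewrite [X in _ <= X]/Rintegral integral_normal_prob_expR_sqr //=.
  rewrite (_ : fine (normal_prob 0 s _) = 1); last first.
    by rewrite [normal_prob _ _ _]probability_setT.
  by rewrite mul1r => ?; rewrite lerBrDl.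
have {}key q : 0 < q -> (q - 1) * ((q + 1) * M) <= (q - 1) * (2 * q ^+ 2 * s ^+ 2).
  move=> q0; have /(ler_wpM2r (ltW s2)) := key q q0.
  move=> /(ler_wpM2r (sqr_ge0 q)).
  set l := (X in X <= _ -> _); set l' := (X in _ -> X <= _).
  have -> : l = l' by rewrite /l /l'; field; rewrite !gt_eqF.
  by move=> /le_trans; apply; rewrite mulr2n; lra.
apply/eqP; rewrite eq_le; apply/andP; split; apply/ler_addgt0Pr => e e0.
- pose t := Num.min 1 (e / (s ^+ 2 *+ 2)).
  have t0 : 0 < t by rewrite lt_min ltr01 divr_gt0.
  have te : t * (s ^+ 2 *+ 2) <= e.
    by rewrite -ler_pdivlMr // ge_min lexx orbT.
  (* The slope from the right, at q = 1 + t. *)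
  have := key (1 + t) ltac:(lra).
  rewrite addrAC subrr add0r ler_pM2l // => h.
  rewrite -(ler_pM2l (_ : 0 < 1 + t + 1)); last lra.
  apply: (le_trans h); have := sqr_ge0 s; move: te; rewrite mulr2n.
  by move: (s ^+ 2) => S; nra.
- pose t := Num.min (2^-1) (e / (s ^+ 2 *+ 2)).
  have t0 : 0 < t by rewrite lt_min divr_gt0 // invr_gt0 ltr0Sn.
  have t1 : t <= 2^-1 by rewrite ge_min lexx.
  have te : t * (s ^+ 2 *+ 2) <= e.
    by rewrite -ler_pdivlMr // ge_min lexx orbT.
  (* The slope from the left, at q = 1 - t. *)
  have := key (1 - t) ltac:(lra).
  rewrite addrAC subrr add0r !mulNr lerN2 ler_pM2l // => h.
  rewrite -(ler_pM2l (_ : 0 < 1 - t + 1)); last lra.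
  rewrite mulrDr; apply: le_trans (lerD h (lexx _)).
  have := sqr_ge0 s; move: te; rewrite mulr2n.
  by move: (s ^+ 2) => S; nra.
Qed.

(** The same comparison for the family of shifted densities: m E <= m^2 s^2 / 2
    for every real m, which is possible only for a mean E = 0. *)
Lemma normal_prob_mean s : 0 < s ->
  (normal_prob 0 s).-integrable setT (EFin \o (fun x : R => x)) /\
  \int[normal_prob 0 s]_x x = 0.
Proof.
move=> s0; pose N := normal_prob 0 s.
have [I2 _] := normal_prob_second_moment s0.
have I1 : N.-integrable setT (EFin \o (fun x : R => 1)).
  by apply: finite_measure_integrable_cst.
have Ix : N.-integrable setT (EFin \o (fun x : R => x)).
  apply: integrable_le (integrable_fD I1 I2) => // x.
  rewrite [leRHS]ger0_norm ?addr_ge0 ?sqr_ge0 //.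
  rewrite -(real_normK (num_real x)); have := normr_ge0 x.
  by move: `|x| => y y0; nra.
split => //; set M := \int[_]_x _.
have key m : m * M <= m ^+ 2 * (s ^+ 2 / 2).
  have Iexp : N.-integrable setT
      (EFin \o (fun x => expR (m * x - m ^+ 2 * s ^+ 2 / 2))).
    apply/integrableP; split.
      apply/measurable_EFinP; apply: measurableT_comp => //.
      by apply: measurable_funB => //; exact: measurable_funM.
    under eq_integral => x _ do rewrite /= ger0_norm ?expR_ge0 //.
    by rewrite integral_normal_prob_expR ?ltry.
  pose k := 1 - m ^+ 2 * s ^+ 2 / 2.
  have Ik : N.-integrable setT (EFin \o (fun x : R => k)).
    by apply: finite_measure_integrable_cst.
  have : \int[N]_x (k + m * x) <=
         \int[N]_x expR (m * x - m ^+ 2 * s ^+ 2 / 2).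
    apply: le_Rintegral => //; first exact/integrable_fD/integrable_fZ.
    move=> x _; apply: le_trans (expR_ge1Dx _).
    by rewrite /k; lra.
  rewrite RintegralD //; last exact: integrable_fZ.
  rewrite RintegralZl // Rintegral_cst //.
  rewrite [X in _ <= X]/Rintegral integral_normal_prob_expR //=.
  rewrite (_ : fine (normal_prob 0 s _) = 1); last first.
    by rewrite [normal_prob _ _ _]probability_setT.
  by rewrite mulr1 /k -/M; lra.
apply/eqP; rewrite -sqrf_eq0 eq_le sqr_ge0 andbT.
have S0 : 0 < s ^+ 2 by rewrite exprn_gt0.
(* The quadratic m^2 s^2 / 2 - m M is minimal at m = M / s^2. *)
have := key (M / s ^+ 2); rewrite exprMn exprVn.
have -> : M / s ^+ 2 * M = M ^+ 2 / s ^+ 2 by ring.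
have -> : M ^+ 2 / s ^+ 2 ^+ 2 * (s ^+ 2 / 2) = M ^+ 2 / s ^+ 2 / 2.
  by field; rewrite gt_eqF.
move=> h; have : M ^+ 2 / s ^+ 2 <= 0 by lra.
by rewrite pmulr_lle0 // invr_gt0.
Qed.

End GaussianMoments.

(** * Independence *)

Section Independence.
Context {R : realType} {d : measure_display} {T : measurableType d}.
Variable P : probability T R.
Variable N : probability (measurableTypeR R) R.
Variables Z D : {mfun T >-> measurableTypeR R}.
Hypothesis indep : forall A B, measurable A -> measurable B ->
  P (Z @^-1` A `&` D @^-1` B) = (P (Z @^-1` A) * N B)%E.

Let law := distribution P Z.
Let ZD o : (measurableTypeR R * measurableTypeR R)%type := (Z o, D o).

Let mZD : measurable_fun setT ZD.
Proof. exact: measurable_fun_pair. Qed.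

(** The product rule on rectangles determines the joint law, so that Fubini's
    theorem applies to products of independent variables. *)
Lemma joint_law_product (A : set (measurableTypeR R * measurableTypeR R)) :
  measurable A -> (law \x N)%E A = P (ZD @^-1` A).
Proof.
pose ZDm : {mfun T >-> (measurableTypeR R * measurableTypeR R)%type} :=
  mfun_Sub (mem_set mZD).
move=> mA.
by rewrite (@product_measure_unique _ _ _ _ _ law N (distribution P ZDm)).
Qed.

Variable psi : R -> R.
Hypothesis mpsi : measurable_fun setT psi.
Hypothesis IZ : P.-integrable setT (EFin \o Z).
Hypothesis Ipsi : N.-integrable setT (EFin \o psi).

Let f (p : measurableTypeR R * measurableTypeR R) : R := p.1 * psi p.2.

Let mf : measurable_fun setT f.
Proof. by apply: measurable_funM => //; exact: measurableT_comp. Qed.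

Let int_law (g : R -> R) : measurable_fun setT g ->
  P.-integrable setT (EFin \o (g \o Z)) ->
  (\int[law]_z (g z)%:E = \int[P]_o (g (Z o))%:E)%E.
Proof.
move=> mg Ig; rewrite integral_distribution //; exact/measurable_EFinP.
Qed.

Let If : (law \x N)%E.-integrable setT (EFin \o f).
Proof.
have mEf : measurable_fun setT (EFin \o f) by exact/measurable_EFinP.
apply/(integrable12ltyP _ _ mEf).
have E z : (\int[N]_y `|(EFin \o f) (z, y)| =
            (`|z| * \int[N]_y `|psi y|)%:E)%E.
  under eq_integral do rewrite /f /= normrM EFinM.
  rewrite ge0_integralZl_EFin //; last first.
    by apply/measurable_EFinP; exact: measurableT_comp.
  rewrite EFinM; congr (_ * _)%E; rewrite /Rintegral fineK //.
  have /(integrable_fin_num measurableT) := integrable_norm Ipsi.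
  exact.
under eq_integral do rewrite E.
rewrite (int_law (g := fun z => `|z| * \int[N]_y `|psi y|)) //.
- have : P.-integrable setT (EFin \o (fun o => (\int[N]_y `|psi y|) * `|Z o|)).
    exact/integrable_fZ/integrable_norm.
  move=> /(integrable_fin_num measurableT).
  rewrite fin_numElt => /andP[_].
  by under eq_integral do rewrite /= mulrC.
- by apply: measurable_funM => //; exact: measurableT_comp.
- have : P.-integrable setT (EFin \o (fun o => (\int[N]_y `|psi y|) * `|Z o|)).
    exact/integrable_fZ/integrable_norm.
  by apply: eq_integrable => // o _; rewrite /= mulrC.
Qed.

Lemma integrable_independent :
  P.-integrable setT (EFin \o (fun o => Z o * psi (D o))).
Proof.
have mEf : measurable_fun setT (EFin \o f) by exact/measurable_EFinP.
apply/integrableP; split.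
  apply/measurable_EFinP; apply: measurable_funM.
    exact: (measurable_integrable IZ).
  exact: measurableT_comp.
pose ZDm : {mfun T >-> (measurableTypeR R * measurableTypeR R)%type} :=
  mfun_Sub (mem_set mZD).
have := (integrableP _ _ _ If).2.
rewrite (eq_measure_integral (distribution P ZDm)) /=; last first.
  by move=> A mA _; exact: joint_law_product.
rewrite ge0_integral_distribution //.
by apply/measurable_EFinP; exact: measurableT_comp.
Qed.

Lemma integral_independent :
  \int[P]_o (Z o * psi (D o)) = (\int[P]_o Z o) * \int[N]_y psi y.
Proof.
have mEf : measurable_fun setT (EFin \o f) by exact/measurable_EFinP.
pose ZDm : {mfun T >-> (measurableTypeR R * measurableTypeR R)%type} :=
  mfun_Sub (mem_set mZD).
have -> : \int[P]_o (Z o * psi (D o)) = fine (\int[law \x N]_p (f p)%:E)%E.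
  rewrite (eq_measure_integral (distribution P ZDm)) /=; last first.
    by move=> A mA _; exact: joint_law_product.
  by rewrite integral_distribution //; exact: integrable_independent.
rewrite -(integral12_prod_meas1 If) /fubini_F.
have E z : (\int[N]_y (EFin \o f) (z, y) = (z * \int[N]_y psi y)%:E)%E.
  rewrite -RintegralZl // /Rintegral fineK //.
  have /(integrable_fin_num measurableT) := integrable_fZ z Ipsi.
  exact.
under eq_integral do rewrite E.
have Ic : P.-integrable setT
    (EFin \o (fun o => Z o * \int[N]_y psi y)).
  have : P.-integrable setT (EFin \o (fun o => (\int[N]_y psi y) * Z o)).
    exact/integrable_fZ.
  by apply: eq_integrable => // o _; rewrite /= mulrC.
rewrite (int_law (g := fun z => z * \int[N]_y psi y)) //; last first.
  exact: measurable_funM.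
by rewrite -[LHS]/(\int[P]_o (Z o * _)) RintegralZr.
Qed.

End Independence.

(** * Functions measurable for a sub-sigma-algebra *)

Section MeasurableWrt.
Context {R : realType} {d : measure_display} {T : measurableType d}.
Variable G : set (set T).
Hypothesis sG : sigma_algebra setT G.
Implicit Types X Y : T -> R.

(** Stability under algebraic operations is inherited from the measurable space
    generated by the sub-sigma-algebra. *)
Lemma measurable_wrtP X :
  measurable_wrt G X <->
  measurable_fun setT (X : g_sigma_algebraType G -> R).
Proof.
split=> [mX _ B mB|mX B mB].
  by rewrite setTI; apply: sub_sigma_algebra; exact: mX.
have := mX measurableT B mB; rewrite setTI.
by rewrite /measurable /= sigma_algebra_id.
Qed.

Lemma measurable_wrt_cst (a : R) : measurable_wrt G (fun=> a).
Proof. by apply/measurable_wrtP; exact: measurable_cst. Qed.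

Lemma measurable_wrtD X Y : measurable_wrt G X -> measurable_wrt G Y ->
  measurable_wrt G (fun o => X o + Y o).
Proof.
by move=> /measurable_wrtP mX /measurable_wrtP mY; apply/measurable_wrtP;
  exact: measurable_funD.
Qed.

Lemma measurable_wrtB X Y : measurable_wrt G X -> measurable_wrt G Y ->
  measurable_wrt G (fun o => X o - Y o).
Proof.
by move=> /measurable_wrtP mX /measurable_wrtP mY; apply/measurable_wrtP;
  exact: measurable_funB.
Qed.

Lemma measurable_wrtM X Y : measurable_wrt G X -> measurable_wrt G Y ->
  measurable_wrt G (fun o => X o * Y o).
Proof.
by move=> /measurable_wrtP mX /measurable_wrtP mY; apply/measurable_wrtP;
  exact: measurable_funM.
Qed.

Lemma measurable_wrt_sum (I : Type) (s : seq I) (X : I -> T -> R) :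
  (forall i, measurable_wrt G (X i)) ->
  measurable_wrt G (fun o => \sum_(i <- s) X i o).
Proof.
move=> mX; elim: s => [|i s IH].
  by under eq_fun do rewrite big_nil; exact: measurable_wrt_cst.
by under eq_fun do rewrite big_cons; exact: measurable_wrtD.
Qed.

Lemma measurable_wrt_measurable X : G `<=` measurable ->
  measurable_wrt G X -> measurable_fun setT X.
Proof. by move=> GT mX _ B mB; rewrite setTI; apply: GT; exact: mX. Qed.

End MeasurableWrt.

Lemma measurable_wrtS (R : realType) (T : Type) (G G' : set (set T))
  (X : T -> R) : G `<=` G' -> measurable_wrt G X -> measurable_wrt G' X.
Proof. by move=> GG' mX B mB; apply: GG'; exact: mX. Qed.

(** * Increments of the Wiener process *)

Section WienerIncrements.
Context {R : realType} {d : measure_display} {T : measurableType d}.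
Variables (P : probability T R) (F : R -> set (set T)) (w : R -> T -> R).
Hypotheses (hF : filtration P F) (hw : wiener P F w).
Implicit Types (s t u v r : R) (Z : T -> R).

Lemma adapted_measurable s Z : 0 <= s -> measurable_wrt (F s) Z ->
  measurable_fun setT Z.
Proof.
move=> s0; apply: measurable_wrt_measurable.
exact: (filtration_sub hF).
Qed.

Lemma adapted_increment s t : 0 <= s -> s <= t ->
  measurable_wrt (F t) (fun o => w t o - w s o).
Proof.
move=> s0 st; have t0 := le_trans s0 st.
have sF := filtration_sigma_algebra hF t0.
apply: (measurable_wrtB sF); first exact: (wiener_adapted hw).
apply: (measurable_wrtS (filtration_le hF s0 st)).
exact: (wiener_adapted hw).
Qed.

Lemma measurable_increment s t : 0 <= s -> s <= t ->
  measurable_fun setT (fun o => w t o - w s o).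
Proof.
move=> s0 st; apply: (adapted_measurable (le_trans s0 st)).
exact: adapted_increment.
Qed.

Section Increment.
Variables s t : R.
Hypotheses (s0 : 0 <= s) (st : s < t).
Let D o := w t o - w s o.
Let N := normal_prob (0 : R) (Num.sqrt (t - s)).
Variable Z : T -> R.
Hypothesis aZ : measurable_wrt (F s) Z.
Hypothesis IZ : P.-integrable setT (EFin \o Z).
Variable psi : R -> R.
Hypothesis mpsi : measurable_fun setT psi.
Hypothesis Ipsi : N.-integrable setT (EFin \o psi).

Let mD : measurable_fun setT D.
Proof. exact/measurable_increment/ltW. Qed.

Let Zm : {mfun T >-> measurableTypeR R} :=
  @mfun_Sub _ _ T (measurableTypeR R) Z (mem_set (measurable_integrable IZ)).
Let Dm : {mfun T >-> measurableTypeR R} :=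
  @mfun_Sub _ _ T (measurableTypeR R) D (mem_set mD).

Let indep A B : measurable A -> measurable B ->
  P (Zm @^-1` A `&` Dm @^-1` B) = (P (Zm @^-1` A) * N B)%E.
Proof.
move=> mA mB; rewrite /N -(wiener_normal hw s0 st mB).
by apply: (wiener_independent hw) => //; exact: aZ.
Qed.

Lemma integrable_increment :
  P.-integrable setT (EFin \o (fun o => Z o * psi (w t o - w s o))).
Proof. exact: (integrable_independent indep). Qed.

Lemma integral_increment :
  \int[P]_o (Z o * psi (w t o - w s o)) = (\int[P]_o Z o) * \int[N]_y psi y.
Proof. exact: (integral_independent indep). Qed.

End Increment.

Lemma integrable_mul_increment s t Z : 0 <= s -> s <= t ->
  measurable_wrt (F s) Z -> P.-integrable setT (EFin \o Z) ->
  P.-integrable setT (EFin \o (fun o => Z o * (w t o - w s o))) /\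
  \int[P]_o (Z o * (w t o - w s o)) = 0.
Proof.
move=> s0; rewrite le_eqVlt => /predU1P[<- _ _|st aZ IZ].
  under eq_fun do rewrite subrr mulr0.
  by split; [exact: integrable0|rewrite Rintegral_cst ?mul0r].
have r0 : 0 < Num.sqrt (t - s) by rewrite sqrtr_gt0 subr_gt0.
have [I1 E1] := normal_prob_mean r0.
split; first exact: (integrable_increment s0 st aZ IZ _ I1).
rewrite (integral_increment s0 st aZ IZ _ I1) //.
by rewrite [X in _ * X]E1 mulr0.
Qed.

Lemma integrable_mul_increment_sqr s t Z : 0 <= s -> s <= t ->
  measurable_wrt (F s) Z -> P.-integrable setT (EFin \o Z) ->
  P.-integrable setT (EFin \o (fun o => Z o * (w t o - w s o) ^+ 2)) /\
  \int[P]_o (Z o * (w t o - w s o) ^+ 2) = (\int[P]_o Z o) * (t - s).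
Proof.
move=> s0; rewrite le_eqVlt => /predU1P[<- _ _|st aZ IZ].
  under eq_fun do rewrite subrr expr0n mulr0.
  rewrite subrr mulr0.
  by split; [exact: integrable0|rewrite Rintegral_cst ?mul0r].
have r0 : 0 < Num.sqrt (t - s) by rewrite sqrtr_gt0 subr_gt0.
have [I1 E1] := normal_prob_second_moment r0.
have mq : measurable_fun setT (fun x : R => x ^+ 2) by exact: measurable_funX.
split; first exact: (integrable_increment s0 st aZ IZ mq I1).
rewrite (integral_increment s0 st aZ IZ mq I1) //.
by rewrite [X in _ * X]E1 sqr_sqrtr // subr_ge0 ltW.
Qed.

End WienerIncrements.

(** * The Ito isometry for simple processes *)

(** Coefficients of steps will be square integrable instead of bounded, so that
    the leading term of the Euler-Maruyama expansion is itself an integral of a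
    simple process. *)
Record step (R : realType) (T : Type) := Step {
  sleft : R ; sright : R ; scoef : T -> R }.

Section Steps.
Context {R : realType} {d : measure_display} {T : measurableType d}.
Variables (P : probability T R) (F : R -> set (set T)) (w : R -> T -> R).
Hypotheses (hF : filtration P F) (hw : wiener P F w).
Local Notation leb := (@lebesgue_measure R).
Local Notation dtP := (leb \x P)%E.
Implicit Types (s t u v r a b : R) (Z : T -> R) (p q : step R T).

Lemma integrable_tensor_indic (A : set (measurableTypeR R)) Z :
  measurable A -> (leb A < +oo)%E -> P.-integrable setT (EFin \o Z) ->
  dtP.-integrable setT
    (EFin \o (fun z : measurableTypeR R * T => Z z.2 * \1_A z.1)) /\
  \int[dtP]_z (Z z.2 * \1_A z.1) = (\int[P]_o Z o) * fine (leb A).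
Proof.
move=> mA Aoo IZ.
pose f (z : measurableTypeR R * T) := Z z.2 * \1_A z.1.
have mf : measurable_fun setT (EFin \o f).
  apply/measurable_EFinP; apply: measurable_funM.
    exact: measurableT_comp (measurable_integrable IZ) _.
  exact: measurableT_comp.
have IA : leb.-integrable setT (EFin \o (\1_A : R -> R)).
  apply/integrableP; split; first exact/measurable_EFinP.
  under eq_integral => x _ do rewrite /= ger0_norm //.
  by rewrite integral_indic // setIT.
have EA c : (\int[leb]_s (c * \1_A s)%:E = (c * fine (leb A))%:E)%E.
  rewrite -[LHS]fineK; last exact: integrable_fin_num (integrable_fZ c IA).
  rewrite [fine _](RintegralZl _ measurableT IA).
  by rewrite /Rintegral integral_indic // setIT.
have If : dtP.-integrable setT (EFin \o f).
  apply/(integrable12ltyP _ _ mf).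
  have E s : (\int[P]_o `|(EFin \o f) (s, o)| =
              ((\int[P]_o `|Z o|) * \1_A s)%:E)%E.
    under eq_integral do rewrite /f /= normrM (ger0_norm (_ : 0 <= \1_A s)) //.
    rewrite -[LHS]fineK.
      by rewrite [fine _](RintegralZr _ measurableT (integrable_norm IZ)).
    apply: integrable_fin_num => //.
    have := integrable_fZ (\1_A s) (integrable_norm IZ).
    by apply: eq_integrable => // o _; rewrite /= mulrC.
  by under eq_integral do rewrite E; rewrite EA ltry.
split => //.
rewrite -[LHS]/(fine (\int[dtP]_z (EFin \o f) z)%E).
rewrite -(integral12_prod_meas1 If) /fubini_F.
have E s : (\int[P]_o (EFin \o f) (s, o) = ((\int[P]_o Z o) * \1_A s)%:E)%E.
  rewrite -[LHS]fineK.
    by rewrite -(RintegralZr _ measurableT IZ).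
  apply: integrable_fin_num => //.
  have := integrable_fZ (\1_A s) IZ.
  by apply: eq_integrable => // o _; rewrite /= mulrC.
by under eq_integral do rewrite E; rewrite EA.
Qed.

Definition adapted_step p : Prop :=
  [/\ 0 <= sleft p, sleft p <= sright p,
      measurable_wrt (F (sleft p)) (scoef p) & sqint P (scoef p)].

Definition step_int p (o : T) : R :=
  scoef p o * (w (sright p) o - w (sleft p) o).

Definition step_proc p (z : measurableTypeR R * T) : R :=
  scoef p z.2 * \1_(`[sleft p, sright p[ : set R) z.1.

(** Beyond the end of the shorter increment the longer one is independent of
    everything before, so only the square of the shorter one contributes. *)
Lemma integrable_mul_two_increments r a b Z : 0 <= r -> r <= a -> r <= b ->
  measurable_wrt (F r) Z -> P.-integrable setT (EFin \o Z) ->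
  P.-integrable setT
    (EFin \o (fun o => Z o * (w a o - w r o) * (w b o - w r o))) /\
  \int[P]_o (Z o * (w a o - w r o) * (w b o - w r o)) =
    (\int[P]_o Z o) * (Num.min a b - r).
Proof.
move=> r0; wlog ab : a b / a <= b => [hwlog ra rb aZ IZ|ra rb aZ IZ].
  have [ab|ba] := leP a b; first by have := hwlog a b ab ra rb aZ IZ;
    rewrite (min_idPl ab).
  have := hwlog b a (ltW ba) rb ra aZ IZ; rewrite (min_idPl (ltW ba)).
  by under eq_fun do rewrite mulrAC.
rewrite (min_idPl ab).
have [I1 E1] := integrable_mul_increment_sqr hF hw r0 ra aZ IZ.
have a0 := le_trans r0 ra; have sFa := filtration_sigma_algebra hF a0.
have [I0 _] := integrable_mul_increment hF hw r0 ra aZ IZ.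
have aZw : measurable_wrt (F a) (fun o => Z o * (w a o - w r o)).
  apply: (measurable_wrtM sFa); last exact: (adapted_increment hF hw).
  by apply: measurable_wrtS aZ; exact: (filtration_le hF).
have [I2 E2] := integrable_mul_increment hF hw a0 ab aZw I0.
have -> : (fun o => Z o * (w a o - w r o) * (w b o - w r o)) =
  (fun o => Z o * (w a o - w r o) ^+ 2 +
            Z o * (w a o - w r o) * (w b o - w a o)).
  by apply/funext => o; ring.
split; first exact: integrable_fD.
by rewrite RintegralD // E1 E2 addr0.
Qed.

Lemma sqint_step_int p : adapted_step p -> sqint P (step_int p).
Proof.
case=> l0 lr aC [mC IC]; split.
  by apply: measurable_funM => //; exact: (measurable_increment hF hw).
have aC2 : measurable_wrt (F (sleft p)) (fun o => scoef p o ^+ 2).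
  under eq_fun do rewrite expr2.
  exact: (measurable_wrtM (filtration_sigma_algebra hF l0)).
have [+ _] := integrable_mul_increment_sqr hF hw l0 lr aC2 IC.
by apply: eq_integrable => // o _; rewrite /step_int /= exprMn.
Qed.

Lemma lebesgue_measure_itv_lty a b : (leb (`[a, b[ : set R) < +oo)%E.
Proof. by rewrite lebesgue_measure_itv /=; case: ifP => _; rewrite ltry. Qed.

Lemma sqint_step_proc p : adapted_step p -> sqint dtP (step_proc p).
Proof.
case=> l0 lr _ [mC IC].
have mi : measurable (`[sleft p, sright p[ : set (measurableTypeR R)).
  exact: measurable_itv.
split.
  apply: measurable_funM; first exact: measurableT_comp.
  exact: measurableT_comp.
have [+ _] := integrable_tensor_indic mi (lebesgue_measure_itv_lty _ _) IC.
apply: eq_integrable => // z _; rewrite /step_proc /= exprMn; congr (_ * _)%:E.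
by rewrite !indicE; case: (_ \in _); rewrite ?expr1n ?expr0n.
Qed.

(** With the steps ordered by their left ends, the first increment is cut at the
    left end of the second one: its part before that time is known when the
    second increment starts and contributes 0, and the remaining parts start at
    the same time. *)
Lemma step_isometry p q : adapted_step p -> adapted_step q ->
  ip P (step_int p) (step_int q) = ip dtP (step_proc p) (step_proc q).
Proof.
wlog pq : p q / sleft p <= sleft q => [hwlog ap aq|].
  have [pq|/ltW qp] := leP (sleft p) (sleft q); first exact: hwlog.
  by rewrite ipC hwlog // ipC.
move=> ap aq; have := (ap, aq).
case: p q pq ap aq => [a b c] [a' b' c'] /= aa' ap aq.
move=> [[/= a0 ab aC sC] [/= a'0 ab' aC' sC']].
have sF' := filtration_sigma_algebra hF a'0.
have aCF : measurable_wrt (F a') c.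
  by apply: measurable_wrtS aC; exact: (filtration_le hF).
pose c2 o := c o * c' o.
have ac2 : measurable_wrt (F a') c2 by exact: (measurable_wrtM sF').
have Ic2 : P.-integrable setT (EFin \o c2) by exact: integrable_mul.
have -> : ip dtP (step_proc (Step a b c)) (step_proc (Step a' b' c')) =
  (\int[P]_o c2 o) * fine (leb (`[a', Num.min b b'[ : set R)).
  have mi : measurable (`[a', Num.min b b'[ : set (measurableTypeR R)).
    exact: measurable_itv.
  have [_ <-] := integrable_tensor_indic mi (lebesgue_measure_itv_lty _ _) Ic2.
  apply: eq_Rintegral => z _; rewrite /step_proc /c2 /=.
  rewrite mulrACA; congr (_ * _); rewrite !indicE -natrM mulnb; congr (_%:R).
  congr nat_of_bool; rewrite -in_setI; congr (_ \in _).
  apply/seteqP; split => x /=; rewrite !in_itv /= lt_min.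
    by case=> /andP[_ ->] /andP[-> ->].
  by case/and3P => a'x -> ->; rewrite a'x (le_trans aa' a'x).
have sp1 : sqint P (step_int (Step a a' c)) by exact: sqint_step_int.
rewrite lebesgue_measure_itv /= lte_fin lt_min.
have E o : step_int (Step a b c) o * step_int (Step a' b' c') o =
  step_int (Step a a' c) o * c' o * (w b' o - w a' o) +
  c2 o * (w b o - w a' o) * (w b' o - w a' o).
  by rewrite /step_int /c2 /=; ring.
have aY : measurable_wrt (F a') (fun o => step_int (Step a a' c) o * c' o).
  apply: (measurable_wrtM sF') => //; apply: (measurable_wrtM sF') => //.
  exact: (adapted_increment hF hw).
have [I1 E1] := integrable_mul_increment hF hw a'0 ab' aY (integrable_mul sp1 sC').
have [ba'|a'b] := leP b a'.
  have sp : sqint P (step_int (Step a b c)) by exact: sqint_step_int.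
  have aX : measurable_wrt (F a') (fun o => step_int (Step a b c) o * c' o).
    have b0 := le_trans a0 ab.
    apply: (measurable_wrtM sF') => //; apply: (measurable_wrtM sF') => //.
    apply: (measurable_wrtS (filtration_le hF b0 ba')).
    exact: (adapted_increment hF hw).
  have [_ E0] := integrable_mul_increment hF hw a'0 ab' aX (integrable_mul sp sC').
  rewrite /= mulr0 -[RHS]E0.
  by apply: eq_Rintegral => o _; rewrite /step_int /=; ring.
have [I2 E2] := integrable_mul_two_increments a'0 (ltW a'b) ab' ac2 Ic2.
rewrite /ip; under eq_Rintegral do rewrite E.
rewrite RintegralD // E1 E2 add0r /=; congr (_ * _).
by case: ltP => [//|b'a'] /=; rewrite (min_idPr _) ?(le_trans b'a') ?(ltW a'b) //;
  apply/eqP; rewrite subr_eq0 eq_le b'a' ab'.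
Qed.

Fixpoint adapted_steps (f : seq (step R T)) : Prop :=
  if f is p :: f' then adapted_step p /\ adapted_steps f' else True.

Definition sint (f : seq (step R T)) (o : T) : R := \sum_(p <- f) step_int p o.

Definition sproc (f : seq (step R T)) (z : measurableTypeR R * T) : R :=
  \sum_(p <- f) step_proc p z.

Lemma sint_cons p f : sint (p :: f) = (fun o => step_int p o + sint f o).
Proof. by apply/funext => o; rewrite /sint big_cons. Qed.

Lemma sproc_cons p f : sproc (p :: f) = (fun z => step_proc p z + sproc f z).
Proof. by apply/funext => z; rewrite /sproc big_cons. Qed.

Lemma sint_nil : sint [::] = (fun=> 0).
Proof. by apply/funext => o; rewrite /sint big_nil. Qed.

Lemma sproc_nil : sproc [::] = (fun=> 0).
Proof. by apply/funext => o; rewrite /sproc big_nil. Qed.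

Lemma sqint_sint f : adapted_steps f -> sqint P (sint f).
Proof.
elim: f => [_|p f IH [ap af]]; first by rewrite sint_nil; exact: sqint0.
by rewrite sint_cons; apply: sqintD; [exact: sqint_step_int|exact: IH].
Qed.

Lemma sqint_sproc f : adapted_steps f -> sqint dtP (sproc f).
Proof.
elim: f => [_|p f IH [ap af]]; first by rewrite sproc_nil; exact: sqint0.
by rewrite sproc_cons; apply: sqintD; [exact: sqint_step_proc|exact: IH].
Qed.

Lemma ito_isometry_simple f g : adapted_steps f -> adapted_steps g ->
  ip P (sint f) (sint g) = ip dtP (sproc f) (sproc g).
Proof.
elim: f => [|p f IH] /=; first by rewrite sint_nil sproc_nil !ip0l.
move=> [ap af] ag; rewrite sint_cons sproc_cons.
rewrite !ipDl ?IH //; try exact: sqint_sint; try exact: sqint_step_int;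
  try exact: sqint_sproc; try exact: sqint_step_proc.
congr (_ + _); elim: g {IH} ag => [_|q g IHg [aq ag]].
  by rewrite sint_nil sproc_nil ipC ip0l ipC ip0l.
rewrite sint_cons sproc_cons.
rewrite !ipDr ?IHg // ?step_isometry //; try exact: sqint_sint;
  try exact: sqint_step_int; try exact: sqint_sproc; exact: sqint_step_proc.
Qed.

Lemma adapted_steps_cat f g : adapted_steps f -> adapted_steps g ->
  adapted_steps (f ++ g).
Proof. by elim: f => //= p f IH [ap af] ag; split => //; exact: IH. Qed.

Lemma sint_cat f g : sint (f ++ g) = (fun o => sint f o + sint g o).
Proof. by apply/funext => o; rewrite /sint big_cat. Qed.

Lemma sproc_cat f g : sproc (f ++ g) = (fun z => sproc f z + sproc g z).
Proof. by apply/funext => z; rewrite /sproc big_cat. Qed.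

Definition scale_step a p : step R T :=
  Step (sleft p) (sright p) (fun o => a * scoef p o).

Lemma adapted_steps_scale a f : adapted_steps f ->
  adapted_steps (map (scale_step a) f).
Proof.
elim: f => //= p f IH [[l0 lr aC sC] af]; split; last exact: IH.
split => //=; last exact: sqintZ.
have sF := filtration_sigma_algebra hF l0.
by apply: (measurable_wrtM sF) => //; exact: measurable_wrt_cst.
Qed.

Lemma sint_scale a f : sint (map (scale_step a) f) = (fun o => a * sint f o).
Proof.
apply/funext => o; rewrite /sint big_map big_distrr /=.
by apply: eq_bigr => p _; rewrite /step_int /= mulrA.
Qed.

Lemma sproc_scale a f : sproc (map (scale_step a) f) = (fun o => a * sproc f o).
Proof.
apply/funext => o; rewrite /sproc big_map big_distrr /=.
by apply: eq_bigr => p _; rewrite /step_proc /= mulrA.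
Qed.

(** The part of a step after time s; a step that ends before s becomes empty. *)
Definition restrict_step s p : step R T :=
  Step (Num.max (sleft p) s) (Num.max (sright p) s) (scoef p).

Lemma adapted_steps_restrict s f : adapted_steps f ->
  adapted_steps (map (restrict_step s) f).
Proof.
elim: f => //= p f IH [[l0 lr aC sC] af]; split; last exact: IH.
split => //=.
- by rewrite le_max l0.
- by rewrite ge_max !le_max lr lexx orbT.
- by apply: measurable_wrtS aC; apply: (filtration_le hF) => //; rewrite le_max lexx.
Qed.

Lemma sproc_restrict s f z :
  sproc (map (restrict_step s) f) z = if s <= z.1 then sproc f z else 0.
Proof.
rewrite /sproc big_map; case: ifP => sz.
  apply: eq_bigr => p _; rewrite /step_proc /= !indicE; congr (_ * _%:R).
  congr nat_of_bool; apply/idP/idP; rewrite !inE /= !in_itv /= ge_max sz andbT.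
    by case/andP => ->; rewrite lt_max [z.1 < s]ltNge sz orbF.
  by case/andP => ->; rewrite lt_max => ->.
apply: big1 => p _; rewrite /step_proc /= indicE.
by rewrite memNset ?mulr0 //= in_itv /= ge_max sz andbF.
Qed.

End Steps.

(** * Limits of integrals of simple processes *)

Section ItoLimit.
Context {R : realType} {d : measure_display} {T : measurableType d}.
Variables (P : probability T R) (F : R -> set (set T)) (w : R -> T -> R).
Hypotheses (hF : filtration P F) (hw : wiener P F w).
Local Notation leb := (@lebesgue_measure R).
Local Notation dtP := (leb \x P)%E.
Implicit Types (s t a b e : R) (Z J : T -> R) (g : measurableTypeR R * T -> R).

(** The closure of the pairs (simple process, integral) in L^2.  Integrands live
    on the whole time axis, so that integrals over different intervals can be
    subtracted. *)
Definition ito_lim g J : Prop :=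
  [/\ sqint dtP g, sqint P J &
    forall e, 0 < e -> exists f, [/\ adapted_steps P F f,
      ip dtP (fun z => sproc f z - g z) (fun z => sproc f z - g z) <= e &
      ip P (fun o => sint w f o - J o) (fun o => sint w f o - J o) <= e]].

Lemma eq_ito_lim g g' J J' : g =1 g' -> J =1 J' -> ito_lim g J -> ito_lim g' J'.
Proof. by move=> /funext -> /funext ->. Qed.

Lemma ito_limD g g' J J' : ito_lim g J -> ito_lim g' J' ->
  ito_lim (fun z => g z + g' z) (fun o => J o + J' o).
Proof.
move=> [sg sJ limJ] [sg' sJ' limJ']; split; try exact: sqintD.
move=> e e0; have e4 : 0 < e / 4 by rewrite divr_gt0.
have [f [af fg fJ]] := limJ _ e4; have [f' [af' fg' fJ']] := limJ' _ e4.
exists (f ++ f'); split; first exact: adapted_steps_cat.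
- have sf := sqint_sproc af; have sf' := sqint_sproc af'.
  have := ip_sqrD (sqintB sf sg) (sqintB sf' sg').
  rewrite sproc_cat.
  have -> : (fun z => sproc f z - g z + (sproc f' z - g' z)) =
            (fun z => sproc f z + sproc f' z - (g z + g' z)).
    by apply/funext => z; ring.
  by lra.
- have sf := sqint_sint hF hw af; have sf' := sqint_sint hF hw af'.
  have := ip_sqrD (sqintB sf sJ) (sqintB sf' sJ').
  rewrite sint_cat.
  have -> : (fun z => sint w f z - J z + (sint w f' z - J' z)) =
            (fun z => sint w f z + sint w f' z - (J z + J' z)).
    by apply/funext => z; ring.
  by lra.
Qed.

Lemma ito_limN g J : ito_lim g J -> ito_lim (fun z => - g z) (fun o => - J o).
Proof.
move=> [sg sJ limJ]; split.
- by apply: eq_sqint (sqintZ (-1) sg) => z; rewrite mulN1r.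
- by apply: eq_sqint (sqintZ (-1) sJ) => z; rewrite mulN1r.
move=> e e0; have [f [af fg fJ]] := limJ _ e0.
exists (map (scale_step (-1)) f); split; first exact: adapted_steps_scale.
- apply: le_trans fg; rewrite le_eqVlt; apply/orP; left; apply/eqP.
  by rewrite sproc_scale; apply: eq_Rintegral => z _; ring.
- apply: le_trans fJ; rewrite le_eqVlt; apply/orP; left; apply/eqP.
  by rewrite sint_scale; apply: eq_Rintegral => z _; ring.
Qed.

Lemma ito_limB g g' J J' : ito_lim g J -> ito_lim g' J' ->
  ito_lim (fun z => g z - g' z) (fun o => J o - J' o).
Proof. by move=> lJ lJ'; exact: ito_limD lJ (ito_limN lJ'). Qed.

Lemma ito_lim_step p : adapted_step P F p ->
  ito_lim (step_proc p) (step_int w p).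
Proof.
move=> ap; have sp := sqint_step_proc ap.
have si := sqint_step_int hF hw ap.
split => // e e0; exists [:: p]; split => //.
- rewrite sproc_cons sproc_nil (_ : (fun z => _) = (fun=> 0)) ?ip0l ?ltW //.
  by apply/funext => z; ring.
- rewrite sint_cons sint_nil (_ : (fun z => _) = (fun=> 0)) ?ip0l ?ltW //.
  by apply/funext => z; ring.
Qed.

(** The isometry survives the limit up to the loss in |a + b|^2 <= 2 |a|^2 +
    2 |b|^2, which is used twice; orders of magnitude are all that matter later. *)
Lemma ito_lim_bound g J : ito_lim g J -> ip P J J <= 4 * ip dtP g g.
Proof.
move=> [sg sJ limJ]; apply/ler_addgt0Pr => e e0.
(* 2 (e / 6) + 2 (2 (e / 6)) = e *)
have e6 : 0 < e / 6 by rewrite divr_gt0.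
have [f [af fg fJ]] := limJ _ e6.
have sf := sqint_sproc af; have si := sqint_sint hF hw af.
have h1 : ip dtP (sproc f) (sproc f) <= 2 * (e / 6) + 2 * ip dtP g g.
  exact: (ip_le_trans sf sg).
have h2 : ip P J J <= 2 * (e / 6) + 2 * (2 * (e / 6) + 2 * ip dtP g g).
  apply: (ip_le_trans sJ si); first by rewrite ip_sqr_sym.
  by rewrite (ito_isometry_simple hF hw).
by lra.
Qed.

(** After time s the variable Z joins the coefficient of every step, and the
    increment that follows has mean zero. *)
Lemma ip_adapted_restrict s Z f : 0 <= s -> measurable_wrt (F s) Z ->
  sqint P Z -> adapted_steps P F f ->
  ip P Z (sint w (map (restrict_step s) f)) = 0.
Proof.
move=> s0 aZ sZ; elim: f => [_|p f IH [ap af]].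
  by rewrite sint_nil ipC ip0l.
have [_] := adapted_steps_restrict hF s (f := [:: p]) (conj ap I).
move: (adapted_steps_restrict hF s (f := p :: f) (conj ap af)) => -[aps afs] _.
rewrite /= sint_cons ipDr //; last 2 first.
- exact: sqint_step_int aps.
- exact: sqint_sint afs.
rewrite IH // addr0; case: aps => /= l0 lr aC sC.
have sl : s <= Num.max (sleft p) s by rewrite le_max lexx orbT.
have aZC : measurable_wrt (F (Num.max (sleft p) s)) (fun o => Z o * scoef p o).
  apply: (measurable_wrtM (filtration_sigma_algebra hF l0)) => //.
  exact: measurable_wrtS (filtration_le hF s0 sl) aZ.
have [_ E] := integrable_mul_increment hF hw l0 lr aZC (integrable_mul sZ sC).
by rewrite -[RHS]E; apply: eq_Rintegral => o _; rewrite /step_int /= mulrA.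
Qed.

(** The approximating simple process may charge times before s, but that part is
    small: there it approximates 0, and the isometry controls its integral. *)
Lemma ito_lim_orth s Z g J : 0 <= s -> measurable_wrt (F s) Z -> sqint P Z ->
  (forall z, z.1 < s -> g z = 0) -> ito_lim g J -> ip P Z J = 0.
Proof.
move=> s0 aZ sZ g0 [sg sJ limJ]; apply/eqP; rewrite -normr_le0.
have key e : 0 < e -> 2 * `|ip P Z J| <= e * (ip P Z Z + 4).
  move=> e0; have [f [af fg fJ]] := limJ (e ^+ 2) (exprn_gt0 2 e0).
  pose h := map (restrict_step s) f.
  have ah : adapted_steps P F h by exact: adapted_steps_restrict.
  (* The part of f before s, written as a simple process. *)
  pose k := f ++ map (scale_step (-1)) h.
  have ak : adapted_steps P F k.
    by apply: adapted_steps_cat => //; exact: adapted_steps_scale.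
  have sf := sqint_sproc af; have si := sqint_sint hF hw af.
  have sh := sqint_sint hF hw ah.
  have kI : ip P (sint w k) (sint w k) <= e ^+ 2.
    rewrite (ito_isometry_simple hF hw) //; apply: le_trans fg.
    apply: ip_le_norm.
    - exact: sqint_sproc ak.
    - exact: sqintB.
    move=> z; rewrite /k sproc_cat sproc_scale sproc_restrict.
    by case: (leP s z.1) => sz; [rewrite mulN1r subrr normr0|rewrite mulr0 addr0 g0 ?subr0].
  have Jh : ip P (fun o => J o - sint w h o) (fun o => J o - sint w h o) <=
      4 * e ^+ 2.
    have := ip_sqr_trans sJ si sh; rewrite (ip_sqr_sym sJ si).
    have <- : sint w k = (fun o => sint w f o - sint w h o).
      by rewrite /k sint_cat sint_scale; apply/funext => o; rewrite mulN1r.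
    by lra.
  have -> : ip P Z J = ip P Z (fun o => J o - sint w h o).
    have := ipDr (sqintB sJ sh) sh sZ; rewrite ip_adapted_restrict // addr0 => <-.
    by apply: eq_Rintegral => o _; rewrite subrK.
  apply: le_trans (ip_young e0 sZ (sqintB sJ sh)) _.
  rewrite mulrDr lerD2l ler_pdivrMl //; apply: (le_trans Jh); lra.
have C0 : 0 < ip P Z Z + 4 by rewrite ltr_wpDl ?ip_ge0.
apply/ler_addgt0Pr => e e0; rewrite add0r.
have := key (e / (ip P Z Z + 4)) (divr_gt0 e0 C0).
by rewrite divfK ?gt_eqF //; have := normr_ge0 (ip P Z J); lra.
Qed.

(** * The Ito integral as a limit of simple processes *)

Lemma tonelli_sqr g : measurable_fun setT g ->
  (\int[dtP]_z (g z ^+ 2)%:E = \int[P]_o \int[leb]_s (g (s, o) ^+ 2)%:E)%E.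
Proof.
move=> mg; apply: (fubini_tonelli2 (fun z => (g z ^+ 2)%:E)) => //.
  exact/measurable_EFinP/measurable_funX.
by move=> z; rewrite lee_fin sqr_ge0.
Qed.

Lemma ipE_prod g : sqint dtP g ->
  ((ip dtP g g)%:E = \int[P]_o \int[leb]_s (g (s, o) ^+ 2)%:E)%E.
Proof.
by move=> sg; rewrite ipE // tonelli_sqr //; case: sg.
Qed.

Lemma sqint_prod g a : measurable_fun setT g ->
  (\int[P]_o \int[leb]_s (g (s, o) ^+ 2)%:E <= a%:E)%E ->
  sqint dtP g /\ ip dtP g g <= a.
Proof.
by move=> mg ga; apply: ip_le => //; rewrite tonelli_sqr.
Qed.

(** Restricting a process to a time window by an indicator turns integrals over
    [0, t] into integrals over the whole product space. *)
Definition window (D : set R) (X : R -> T -> R) (z : measurableTypeR R * T) : R :=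
  X z.1 z.2 * \1_D z.1.

Lemma integral_window (D : set R) (X : R -> T -> R) o : measurable D ->
  (\int[leb]_(s in D) (X s o ^+ 2)%:E =
   \int[leb]_s ((window D X (s, o)) ^+ 2)%:E)%E.
Proof.
move=> mD; rewrite integral_mkcond; apply: eq_integral => s _.
rewrite patchE /window /= indicE; case: ifP => sD; first by rewrite mulr1.
by rewrite mulr0 expr0n.
Qed.

Lemma measurable_window (D : set R) (X : R -> T -> R) : measurable D ->
  measurable_fun (D `*` setT) (fun p : measurableTypeR R * T => X p.1 p.2) ->
  measurable_fun setT (window D X).
Proof.
move=> mD mX.
have mDT : measurable (D `*` setT : set (measurableTypeR R * T)).
  exact: measurableX.
have := (measurable_restrictT _ mDT).1 mX.
congr measurable_fun; apply/funext => -[s o]; rewrite patchE /window /= indicE.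
have -> : ((s, o) \in D `*` setT) = (s \in D).
  by apply/idP/idP; rewrite !inE /= => // -[].
by case: ifP => _; rewrite ?mulr1 ?mulr0.
Qed.

Lemma sqint_window t X : ito_integrand P F t X -> sqint dtP (window `[0, t] X).
Proof.
move=> [mX _ LX]; have mg := measurable_window (measurable_itv `[0, t]) mX.
have mi : measurable (`[0, t] : set R) by exact: measurable_itv.
apply: (sqint_lty mg); rewrite (tonelli_sqr mg).
apply: le_lt_trans LX; rewrite le_eqVlt; apply/orP; left; apply/eqP.
by apply: eq_integral => o _; rewrite integral_window.
Qed.

Definition elementary_steps (f : elementary R T) : seq (step R T) :=
  [seq Step (etime f i) (etime f i.+1) (ecoef f i) | i <- iota 0 (esize f)].

Lemma sint_elementary f : sint w (elementary_steps f) = elementary_integral w f.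
Proof.
apply/funext => o; rewrite /sint big_map /elementary_integral.
by rewrite -[esize f]subn0 -/(index_iota 0 _) big_mkord subn0.
Qed.

Lemma sproc_elementary f z :
  sproc (elementary_steps f) z = elementary_process f z.1 z.2.
Proof.
rewrite /sproc big_map /elementary_process.
by rewrite -[esize f]subn0 -/(index_iota 0 _) big_mkord subn0.
Qed.

Section ElementaryOn.
Variables (t : R) (f : elementary R T).
Hypothesis ef : elementary_on F t f.

Lemma etime_mono i j : (i <= j)%N -> (j <= esize f)%N -> etime f i <= etime f j.
Proof.
case: ef => _ mono _ _; elim: j => [|j IH]; first by rewrite leqn0 => /eqP ->.
rewrite leq_eqVlt => /predU1P[-> //|]; rewrite ltnS => ij jf.
by apply: (le_trans (IH ij (ltnW jf))); exact: mono.
Qed.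

Lemma etime_ge0 i : (i <= esize f)%N -> 0 <= etime f i.
Proof. by move=> h; case: ef => h0 _ _ _; apply: (le_trans h0); exact: etime_mono. Qed.

Lemma adapted_elementary : adapted_steps P F (elementary_steps f).
Proof.
rewrite /elementary_steps.
have : forall i, (i \in iota 0 (esize f)) -> (i < esize f)%N.
  by move=> i; rewrite mem_iota.
elim: (iota 0 _) => //= i s IH hs; split; last first.
  by apply: IH => j js; apply: hs; rewrite inE js orbT.
have {}hs : (i < esize f)%N by apply: hs; rewrite inE eqxx.
have t0 : 0 <= etime f i by apply: etime_ge0; exact: ltnW.
case: ef => _ mono _ /(_ i hs)[aC [M CM]]; split => //=; first exact: mono.
have mC := adapted_measurable hF t0 aC.
split => //; have IM : P.-integrable setT (EFin \o (fun=> M ^+ 2)).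
  exact: finite_measure_integrable_cst.
apply: (integrable_le _ _ IM); first exact: measurable_funX.
move=> o; rewrite !normrX lerXn2r ?nnegrE // [leRHS]ger0_norm //.
exact: le_trans (CM o).
Qed.

Lemma elementary_process0 s o : ~~ (0 <= s <= t) -> elementary_process f s o = 0.
Proof.
move=> st; apply: big1 => i _; rewrite indicE memNset ?mulr0 //= in_itv /=.
apply/negP; apply: contraNN st => /andP[h1 h2].
rewrite (le_trans _ h1) ?etime_ge0 ?(ltnW (ltn_ord i)) //=.
apply: (le_trans (ltW h2)); case: ef => _ _ ft _.
by apply: (le_trans _ ft); apply: etime_mono.
Qed.

End ElementaryOn.

Lemma ito_integral_lim t X I : ito_integral P F w t X I ->
  ito_lim (window `[0, t] X) I.
Proof.
move=> [iX mI [f [ef fX fI]]].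
have mi : measurable (`[0, t] : set R) by exact: measurable_itv.
have sX := sqint_window iX.
have approx e : 0 < e -> exists2 h, elementary_on F t h &
    (\int[P]_o \int[leb]_(s in `[0%R, t])
       ((elementary_process h s o - X s o) ^+ 2)%:E <= e%:E)%E /\
    (\int[P]_o ((elementary_integral w h o - I o) ^+ 2)%:E <= e%:E)%E.
  move=> e0; have ee : (0%E < e%:E)%E by rewrite lte_fin.
  have [N1 _ h1] := fX _ (open_ereal_lt' ee).
  have [N2 _ h2] := fI _ (open_ereal_lt' ee).
  exists (f (maxn N1 N2)) => //; split; apply: ltW.
    exact: (h1 _ (leq_maxl N1 N2)).
  exact: (h2 _ (leq_maxr N1 N2)).
have sI : sqint P I.
  have [h eh [_ hI]] := approx 1 ltr01.
  have sh := sqint_sint hF hw (adapted_elementary eh).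
  have mhI : measurable_fun setT (fun o => elementary_integral w h o - I o).
    by apply: measurable_funB => //; rewrite -sint_elementary; case: sh.
  have [shI _] := ip_le mhI hI.
  apply: eq_sqint (sqintB sh shI) => o.
  by rewrite sint_elementary; ring.
split => // e e0; have [h eh [hX hI]] := approx e e0.
have ah := adapted_elementary eh.
exists (elementary_steps h); split => //.
- apply: (sqint_prod _ _).2.
    apply: measurable_funB; last by case: sX.
    by have [] := sqint_sproc ah.
  apply: le_trans hX; rewrite le_eqVlt; apply/orP; left; apply/eqP.
  apply: eq_integral => o _; rewrite (integral_window (fun s o => elementary_process h s o - X s o)) //.
  apply: eq_integral => s _; congr (_ ^+ 2)%:E.
  rewrite sproc_elementary /window /= indicE.
  have [st|st] := boolP (0 <= s <= t).
    by rewrite mem_set ?mulr1 //= in_itv.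
  rewrite memNset /=; last by rewrite in_itv; exact/negP.
  by rewrite (elementary_process0 eh) // !mulr0 subr0.
- rewrite sint_elementary; apply: (ip_le _ _).2 => //.
  by apply: measurable_funB => //; rewrite -sint_elementary; case: (sqint_sint hF hw ah).
Qed.

End ItoLimit.

(** * Mean-square estimates for time integrals *)

Section TimeIntegrals.
Context {R : realType} {d : measure_display} {T : measurableType d}.
Variable P : probability T R.
Local Notation leb := (@lebesgue_measure R).
Local Notation dtP := (leb \x P)%E.
Implicit Types (s t a b K L : R) (D : T -> R).
Implicit Types h : measurableTypeR R * T -> R.

Lemma measurable_section h o : measurable_fun setT h ->
  measurable_fun setT (fun s : measurableTypeR R => h (s, o)).
Proof. by move=> mh; apply: (measurableT_comp mh); exact: measurable_pair2. Qed.

Lemma sqint_itv a b : sqint leb (\1_`[a, b] : R -> R) /\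
  (a <= b -> ip leb (\1_`[a, b]) (\1_`[a, b]) = b - a).
Proof.
have mi : measurable (`[a, b] : set R) by exact: measurable_itv.
have E : (\int[leb]_x (\1_`[a, b] x ^+ 2)%:E = leb `[a, b])%E.
  transitivity (\int[leb]_x (\1_(`[a, b] : set R) x)%:E)%E; last first.
    by rewrite integral_indic // setIT.
  apply: eq_integral => x _; rewrite indicE.
  by case: (_ \in _); rewrite ?expr1n ?expr0n.
have s1 : sqint leb (\1_`[a, b] : R -> R).
  apply: sqint_lty; first exact: measurable_indic.
  by rewrite E lebesgue_measure_itv /=; case: ifP => _; rewrite ltry.
split => // ab; apply: EFin_inj; rewrite ipE // E lebesgue_measure_itv /= lte_fin.
by case: ltgtP ab => // -> _; rewrite subrr.
Qed.

Lemma Rintegral_probability (c : R) : \int[P]_o c = c.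
Proof.
rewrite Rintegral_cst // -[RHS]mulr1; congr (_ * _).
exact: (congr1 fine (probability_setT P)).
Qed.

Lemma sqint_cst (c : R) : sqint P (fun=> c).
Proof.
split; first exact: measurable_cst.
exact: finite_measure_integrable_cst.
Qed.

(** The bound is assumed on the open interval only, because half-open windows of
    both kinds occur and the endpoints are negligible. *)
Lemma ip_slices h a b K : 0 <= K -> a < b -> measurable_fun setT h ->
  (forall s o, ~~ (a <= s <= b) -> h (s, o) = 0) ->
  (forall s, a < s < b -> (\int[P]_o (h (s, o) ^+ 2)%:E <= K%:E)%E) ->
  sqint dtP h /\ ip dtP h h <= K * (b - a).
Proof.
move=> K0 ab mh h0 hK; apply: ip_le => //.
have mh2 : measurable_fun setT (fun z => (h z ^+ 2)%:E).
  exact/measurable_EFinP/measurable_funX.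
have h20 z : (0 <= (h z ^+ 2)%:E)%E by rewrite lee_fin sqr_ge0.
rewrite (fubini_tonelli1 (fun z => (h z ^+ 2)%:E)) //.
have mphi := measurable_fun_fubini_tonelli_F (m2 := P) _ mh2 h20.
set phi := fubini_F _ _ in mphi *.
have -> : (\int[leb]_s phi s = \int[leb]_(s in `[a, b]) phi s)%E.
  rewrite [RHS]integral_mkcond; apply: eq_integral => s _; rewrite patchE.
  case: ifPn => // sab; rewrite /phi /fubini_F.
  under eq_integral => o _.
    rewrite h0; last by move: sab; rewrite notin_setE /= in_itv => /negP.
    rewrite expr0n /=; over.
  by rewrite integral0.
rewrite -integral_itv_bndo_bndc; last exact: measurable_funTS.
rewrite -integral_itv_obnd_cbnd; last exact: measurable_funTS.
apply: (@le_trans _ _ (\int[leb]_(s in `]a, b[) (cst K%:E s))%E).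
  apply: ge0_le_integral => //.
  - by move=> s _; apply: integral_ge0.
  - exact: measurable_funTS.
by rewrite integral_cst //= lebesgue_measure_itv /= lte_fin ab -EFinD -EFinM.
Qed.

(** Cauchy-Schwarz in time, then Tonelli.  The length is replaced by a bound L > 0
    because 0 times an infinite integral would lose the inequality. *)
Lemma ip_time_integral h D a b L : 0 < L -> a <= b -> b - a <= L ->
  sqint dtP h -> (forall s o, ~~ (a <= s <= b) -> h (s, o) = 0) ->
  measurable_fun setT D ->
  {ae P, forall o, D o = \int[leb]_s h (s, o)} ->
  sqint P D /\ ip P D D <= L * ip dtP h h.
Proof.
move=> L0 ab bL sh h0 mD DE; apply: ip_le => //.
have [mh _] := sh.
have mh2 : measurable_fun setT (fun z => (h z ^+ 2)%:E).
  exact/measurable_EFinP/measurable_funX.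
have h20 z : (0 <= (h z ^+ 2)%:E)%E by rewrite lee_fin sqr_ge0.
have mphi := measurable_fun_fubini_tonelli_G (m1 := leb) _ mh2 h20.
rewrite EFinM ipE_prod // -ge0_integralZl_EFin //; last 2 first.
- by move=> o _; apply: integral_ge0.
- exact: ltW.
apply: ae_ge0_le_integral => //.
- by move=> o _; rewrite lee_fin sqr_ge0.
- exact/measurable_EFinP/measurable_funX.
- by move=> o _; rewrite mule_ge0 ?lee_fin ?(ltW L0) //; apply: integral_ge0.
- by apply: emeasurable_funM.
apply: filterS DE => o -> _.
have mo := measurable_section o mh.
have [fin|] := ltP (\int[leb]_s (h (s, o) ^+ 2)%:E)%E +oo%E; last first.
  by rewrite leye_eq => /eqP ->; rewrite gt0_muley ?lte_fin // leey.
have so := sqint_lty mo fin.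
have [s1 E1] := sqint_itv a b.
have -> : \int[leb]_s h (s, o) = ip leb (fun s => h (s, o)) (\1_`[a, b]).
  apply: eq_Rintegral => s _; rewrite indicE.
  case: (boolP (s \in _)) => [_|]; first by rewrite mulr1.
  rewrite notin_setE /= in_itv => /negP sab.
  by rewrite h0 // mul0r.
rewrite -ipE // -EFinM lee_fin.
apply: le_trans (ip_cauchy_schwarz so s1) _.
by rewrite mulrC E1 // ler_wpM2r // ip_ge0.
Qed.

Lemma ae_integrable_section h a b : sqint dtP h ->
  (forall s o, ~~ (a <= s <= b) -> h (s, o) = 0) ->
  {ae P, forall o, leb.-integrable setT (EFin \o (fun s => h (s, o)))}.
Proof.
move=> sh h0; have [mh _] := sh.
have mi : measurable (`[a, b] : set (measurableTypeR R)).
  exact: measurable_itv.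
have s1 : sqint dtP (fun z => \1_(`[a, b] : set R) z.1).
  have I1 : P.-integrable setT (EFin \o (fun=> 1)).
    exact: finite_measure_integrable_cst.
  have lty : (leb (`[a, b] : set R) < +oo)%E.
    by rewrite lebesgue_measure_itv /=; case: ifP => _; rewrite ltry.
  split; first exact: measurableT_comp.
  have [+ _] := integrable_tensor_indic mi lty I1.
  apply: eq_integrable => // z _; rewrite /= mul1r indicE.
  by case: (_ \in _); rewrite ?expr1n ?expr0n.
have Ih : dtP.-integrable setT (EFin \o h).
  have := integrable_mul sh s1.
  apply: eq_integrable => // -[s o] _ /=; rewrite indicE.
  case: (boolP (s \in _)) => [_|]; first by rewrite mulr1.
  by rewrite notin_setE /= in_itv => /negP sab; rewrite h0 // mul0r.
exact: ae_integrable2 Ih.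
Qed.

End TimeIntegrals.

(** * One Euler step *)

Section Solution.
Context {R : realType} {d : measure_display} {T : measurableType d}.
Variables (P : probability T R) (F : R -> set (set T)) (w : R -> T -> R).
Hypotheses (hF : filtration P F) (hw : wiener P F w).
Variables (n : nat) (M N : 'M[R]_n) (x0 : 'cV[R]_n) (x : R -> T -> 'cV[R]_n).
Hypothesis sol : sde_solution P F w M N x0 x.
Local Notation leb := (@lebesgue_measure R).
Local Notation dtP := (leb \x P)%E.
Implicit Types (s t a b K : R) (i j : 'I_n) (B : 'M[R]_n) (D : set R).

Definition component i s o : R := x s o i 0.
Definition lin B i s o : R := (B *m x s o) i 0.

Lemma linE B i s o : lin B i s o = \sum_j B i j * component j s o.
Proof. by rewrite /lin mxE. Qed.

Lemma measurable_component s i : 0 <= s -> measurable_wrt (F s) (component i s).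
Proof. by move=> s0; apply: (ito_integrand_adapted (sde_integrand sol i s0)). Qed.

Lemma measurable_lin B s i : 0 <= s -> measurable_wrt (F s) (lin B i s).
Proof.
move=> s0; have sF := filtration_sigma_algebra hF s0.
have -> : lin B i s = (fun o => \sum_j B i j * component j s o).
  by apply/funext => o; exact: linE.
apply: (measurable_wrt_sum sF) => j.
by apply: (measurable_wrtM sF); [exact: measurable_wrt_cst|exact: measurable_component].
Qed.

Lemma window_lin D B i z : window D (lin B i) z = \sum_j B i j * window D (component j) z.
Proof.
by rewrite /window linE mulr_suml; apply: eq_bigr => j _; rewrite mulrA.
Qed.

Lemma sqint_window0 B i t : 0 <= t -> sqint dtP (window `[0, t] (lin B i)).
Proof.
move=> t0; have sc j : sqint dtP (fun z => B i j * window `[0, t] (component j) z).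
  by apply: sqintZ; apply: sqint_window (sde_integrand sol j t0).
by apply: eq_sqint (sqint_sum (index_enum 'I_n) sc) => z; rewrite window_lin.
Qed.

Lemma window_itvB (X : R -> T -> R) a b z : 0 <= a -> a <= b ->
  window `]a, b] X z = window `[0, b] X z - window `[0, a] X z.
Proof.
move=> a0 ab; rewrite /window -mulrBr; congr (_ * _); rewrite !indicE !mem_setE !in_itv /=.
case: (leP z.1 a) => za; last first.
  by rewrite (le_trans a0 (ltW za)) /= subr0.
by rewrite (le_trans za ab) subrr.
Qed.

Lemma sqint_window_itv B i a b : 0 <= a -> a <= b ->
  sqint dtP (window `]a, b] (lin B i)).
Proof.
move=> a0 ab; have b0 := le_trans a0 ab.
apply: eq_sqint (sqintB (sqint_window0 B i b0) (sqint_window0 B i a0)) => z.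
by rewrite window_itvB.
Qed.

Lemma window0 D (X : R -> T -> R) s o : ~ D s -> window D X (s, o) = 0.
Proof. by move=> nDs; rewrite /window /= indicE memNset ?mulr0. Qed.

Lemma sde_integral_eq t i : 0 <= t -> exists2 I : T -> R,
  ito_lim P F w (window `[0, t] (lin N i)) I &
  {ae P, forall o, component i t o = x0 i 0 +
     \int[leb]_s window `[0, t] (lin M i) (s, o) + I o}.
Proof.
move=> t0; have [I iI eqI] := sde_equation sol i t0.
exists I; first exact: ito_integral_lim.
apply: filterS eqI => o; rewrite /component => ->; congr (_ + _ + _).
rewrite Rintegral_mkcond; apply: eq_Rintegral => s _.
rewrite patchE /window /= indicE; case: ifP => _; first by rewrite mulr1.
by rewrite mulr0.
Qed.

(** Integrals over [0, a] and [0, b] are approximated by unrelated simple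
    processes; subtracting them in [ito_lim] gives the integral over ]a, b]. *)
Lemma sde_increment i a b : 0 <= a -> a <= b -> exists2 J : T -> R,
  ito_lim P F w (window `]a, b] (lin N i)) J &
  {ae P, forall o, component i b o - component i a o - J o =
     \int[leb]_s window `]a, b] (lin M i) (s, o)}.
Proof.
move=> a0 ab; have b0 := le_trans a0 ab.
have [Ia lIa Ea] := sde_integral_eq i a0.
have [Ib lIb Eb] := sde_integral_eq i b0.
exists (fun o => Ib o - Ia o).
  apply: eq_ito_lim (ito_limB hF hw lIb lIa) => // z.
  by rewrite window_itvB.
have out t s o : ~~ (0 <= s <= t) -> window `[0, t] (lin M i) (s, o) = 0.
  by move=> /negP st; apply: window0; rewrite /= in_itv.
have Sa := ae_integrable_section (sqint_window0 M i a0) (out a).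
have Sb := ae_integrable_section (sqint_window0 M i b0) (out b).
apply: filterS2 (filterI Ea Eb) (filterI Sa Sb) => o [-> ->] [Iao Ibo].
under [RHS]eq_Rintegral do rewrite window_itvB //.
by rewrite RintegralB //; ring.
Qed.

(** A solution is square integrable on [0, T0] x Omega by definition, and the
    equation turns this into a bound at every single time. *)
Lemma component_bound (T0 : R) : 0 < T0 ->
  exists2 K, 0 <= K & forall i t, 0 <= t <= T0 ->
    sqint P (component i t) /\ ip P (component i t) (component i t) <= K.
Proof.
move=> T00; apply: exists_uniform.
  by move=> i K K' KK' h t tT; have [sc cK] := h t tT; split => //; exact: le_trans KK'.
move=> i.
pose KM := ip dtP (window `[0, T0] (lin M i)) (window `[0, T0] (lin M i)).
pose KN := ip dtP (window `[0, T0] (lin N i)) (window `[0, T0] (lin N i)).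
have KM0 : 0 <= KM by exact: ip_ge0.
have KN0 : 0 <= KN by exact: ip_ge0.
have T0' := ltW T00.
exists (2 * (T0 * KM) + 2 * (2 * x0 i 0 ^+ 2 + 2 * (4 * KN))).
  by have := sqr_ge0 (x0 i 0); have := mulr_ge0 T0' KM0; lra.
move=> t /andP[t0 tT].
have mono B : ip dtP (window `[0, t] (lin B i)) (window `[0, t] (lin B i)) <=
    ip dtP (window `[0, T0] (lin B i)) (window `[0, T0] (lin B i)).
  apply: ip_le_norm; try exact: sqint_window0.
  move=> z; rewrite /window !normrM ler_wpM2l // !indicE.
  case: (boolP (z.1 \in `[0, t]%classic)) => [|_]; last by rewrite normr0.
  rewrite mem_setE in_itv /= => /andP[z0 zt].
  by rewrite mem_set //= in_itv /= z0 (le_trans zt).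
have [I lI E] := sde_integral_eq i t0.
have [_ sI _] := lI.
have IN : ip P I I <= 4 * KN.
  apply: (le_trans (ito_lim_bound hF hw lI)).
  by rewrite ler_pM2l //; exact: mono.
have sx0 := sqint_cst P (x0 i 0).
have ix0 : ip P (fun=> x0 i 0) (fun=> x0 i 0) = x0 i 0 ^+ 2.
  by rewrite /ip Rintegral_probability.
have mcomponent := adapted_measurable hF t0 (measurable_component i t0).
have [] := @ip_time_integral _ _ _ P (window `[0, t] (lin M i))
  (fun o => component i t o - (x0 i 0 + I o)) 0 t T0 T00 t0.
- by rewrite subr0.
- exact: sqint_window0.
- by move=> s o /negP st; apply: window0; rewrite /= in_itv.
- by apply: measurable_funB => //; apply: measurable_funD => //; case: sI.
- by apply: filterS E => o ->; ring.
move=> sD DM; have sxI := sqintD sx0 sI.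
have sc : sqint P (component i t).
  by apply: eq_sqint (sqintD sD sxI) => o; ring.
split => //; apply: (ip_le_trans sc sxI).
  by apply: (le_trans DM); rewrite ler_pM2l //; exact: mono.
by apply: (le_trans (ip_sqrD sx0 sI)); rewrite ix0; lra.
Qed.

(** Both integrals over [0, 0] vanish, the stochastic one in mean square. *)
Lemma initial_moment i j :
  ip P (component i 0) (component j 0) = x0 i 0 * x0 j 0.
Proof.
have zero k : exists2 I : T -> R, sqint P I /\ ip P I I = 0 &
    {ae P, forall o, component k 0 o = x0 k 0 + I o}.
  have [I lI E] := sde_integral_eq k (lexx 0); exists I.
    have [_ sI _] := lI; split => //.
    apply/eqP; rewrite eq_le ip_ge0 andbT.
    apply: le_trans (ito_lim_bound hF hw lI) _.
    apply/ler_addgt0Pr => e e0; rewrite add0r.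
    suff -> : ip dtP (window `[0, 0] (lin N k)) (window `[0, 0] (lin N k)) = 0.
      by rewrite mulr0 ltW.
    apply: EFin_inj; rewrite ipE_prod; last exact: sqint_window0.
    under eq_integral do rewrite -(integral_window (lin N k)) // set_itv1 integral_set1.
    by rewrite integral0.
  apply: filterS E => o ->.
  rewrite (_ : \int[leb]_s _ = 0) ?addr0 //.
  transitivity (\int[leb]_(s in `[0%R, 0%R]) lin M k s o).
    rewrite [RHS]Rintegral_mkcond; apply: eq_Rintegral => s _.
    rewrite patchE /window /= indicE; case: ifP => _; first by rewrite mulr1.
    by rewrite mulr0.
  by rewrite set_itv1 Rintegral_set1.
have [I [sI I0] EI] := zero i; have [J [sJ J0] EJ] := zero j.
have ip_null (f g : T -> R) : sqint P f -> sqint P g -> ip P f f = 0 -> ip P f g = 0.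
  move=> sf sg f0; have := ip_cauchy_schwarz sf sg; rewrite f0 mul0r => h.
  by apply/eqP; rewrite -sqrf_eq0 eq_le h sqr_ge0.
have mc k := adapted_measurable hF (lexx 0) (measurable_component k (lexx 0)).
have sxI k (f : T -> R) : sqint P f -> sqint P (fun o => x0 k 0 + f o).
  by move=> sf; apply: sqintD => //; exact: sqint_cst.
rewrite (ip_ae (mc i) (f' := fun o => x0 i 0 + I o)) //; last by case: (sxI i I sI).
rewrite ipC (ip_ae (mc j) (f' := fun o => x0 j 0 + J o)) //; last 2 first.
- by case: (sxI j J sJ).
- by case: (sxI i I sI).
rewrite (ipDl (sqint_cst P _) sJ (sxI i I sI)).
rewrite (ip_null _ _ sJ (sxI i I sI) J0) addr0.
rewrite (ipDr (sqint_cst P _) sI (sqint_cst P _)).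
rewrite [X in _ + X]ipC (ip_null _ _ sI (sqint_cst P _) I0) addr0.
by rewrite /ip Rintegral_probability mulrC.
Qed.

(** A matrix norm that bounds every row sum and every entry of the matrix. *)
Definition mxsum B : R := \sum_i \sum_j `|B i j|.

Lemma mxsum_row B i : (\sum_j `|B i j|) ^+ 2 <= mxsum B ^+ 2.
Proof.
rewrite lerXn2r ?nnegrE ?sumr_ge0 // => [k _|]; first by rewrite sumr_ge0.
rewrite /mxsum [leRHS](bigD1 i) //= lerDl.
by apply: sumr_ge0 => k _; apply: sumr_ge0.
Qed.

Lemma lin_bound (T0 : R) B : 0 < T0 ->
  exists2 K, 0 <= K & forall i t, 0 <= t <= T0 ->
    sqint P (lin B i t) /\ ip P (lin B i t) (lin B i t) <= K.
Proof.
move=> T00; have [K K0 cK] := component_bound T00.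
exists (mxsum B ^+ 2 * K); first by rewrite mulr_ge0 ?sqr_ge0.
move=> i t tT.
have -> : lin B i t = (fun o => \sum_j B i j * component j t o).
  by apply/funext => o; exact: linE.
have [s1 s2] := ip_lincomb_le (B i) K0 (fun j => (cK j t tT).1)
  (fun j => (cK j t tT).2).
by split => //; apply: (le_trans s2); rewrite ler_wpM2r ?mxsum_row.
Qed.

(** Square-root continuity in mean square, which makes freezing the coefficients
    over one step an error of higher order. *)
Lemma component_increment_bound (T0 : R) : 0 < T0 ->
  exists2 K, 0 <= K & forall i a b, 0 <= a -> a < b -> b <= T0 ->
    ip P (fun o => component i b o - component i a o)
         (fun o => component i b o - component i a o) <= K * (b - a).
Proof.
move=> T00; have [KM KM0 bM] := lin_bound M T00; have [KN KN0 bN] := lin_bound N T00.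
have T0' := ltW T00.
exists (2 * (T0 * KM) + 2 * (4 * KN)).
  by have := mulr_ge0 T0' KM0; lra.
move=> i a b a0 ab bT; have ab' := ltW ab; have b0 := le_trans a0 ab'.
have slices B K : 0 <= K -> (forall i t, 0 <= t <= T0 ->
    sqint P (lin B i t) /\ ip P (lin B i t) (lin B i t) <= K) ->
    ip dtP (window `]a, b] (lin B i)) (window `]a, b] (lin B i)) <= K * (b - a).
  move=> K0 bK; apply: (ip_slices K0 ab _ _ _).2.
  - by case: (sqint_window_itv B i a0 ab').
  - move=> s o /negP sab; apply: window0; rewrite /= in_itv /= => /andP[h1 h2].
    by apply: sab; rewrite (ltW h1) h2.
  - move=> s /andP[sa sb].
    have [|s1 s2] := bK i s; first by rewrite (le_trans a0 (ltW sa)) (le_trans (ltW sb)).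
    apply: le_trans (_ : (ip P (lin B i s) (lin B i s))%:E <= _)%E; last by rewrite lee_fin.
    rewrite ipE //; rewrite le_eqVlt; apply/orP; left; apply/eqP.
    apply: eq_integral => o _; rewrite /window /= indicE mem_set ?mulr1 //=.
    by rewrite in_itv /= sa ltW.
have [J lJ E] := sde_increment i a0 ab'.
have [_ sJ _] := lJ.
have J4 := ito_lim_bound hF hw lJ.
have sca : sqint P (component i a).
  have [K _ cK] := component_bound T00.
  by case: (cK i a); rewrite ?a0 ?(le_trans ab').
have scb : sqint P (component i b).
  have [K _ cK] := component_bound T00.
  by case: (cK i b); rewrite ?b0 ?bT.
have sba := sqintB scb sca.
have [] := @ip_time_integral _ _ _ P (window `]a, b] (lin M i))
  (fun o => component i b o - component i a o - J o) a b T0 T00 ab'.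
- by rewrite lerBlDr (le_trans bT) // lerDl.
- exact: sqint_window_itv.
- move=> s o /negP sab; apply: window0; rewrite /= in_itv /= => /andP[h1 h2].
  by apply: sab; rewrite (ltW h1) h2.
- by case: (sqintB sba sJ).
- exact: E.
move=> sA A2.
have -> : (2 * (T0 * KM) + 2 * (4 * KN)) * (b - a) =
    2 * (T0 * (KM * (b - a))) + 2 * (4 * (KN * (b - a))) by ring.
apply: (ip_le_trans sba sJ).
  by apply: (le_trans A2); rewrite ler_pM2l //; exact: slices.
by apply: (le_trans J4); rewrite ler_pM2l //; exact: slices.
Qed.

Lemma lin_increment_bound (T0 : R) B : 0 < T0 ->
  exists2 K, 0 <= K & forall i a b, 0 <= a -> a < b -> b <= T0 ->
    sqint P (fun o => lin B i b o - lin B i a o) /\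
    ip P (fun o => lin B i b o - lin B i a o)
         (fun o => lin B i b o - lin B i a o) <= K * (b - a).
Proof.
move=> T00; have [K K0 cK] := component_increment_bound T00.
have [K' _ cK'] := component_bound T00.
exists (mxsum B ^+ 2 * K); first by rewrite mulr_ge0 ?sqr_ge0.
move=> i a b a0 ab bT.
have -> : (fun o => lin B i b o - lin B i a o) =
    (fun o => \sum_j B i j * (component j b o - component j a o)).
  apply/funext => o; rewrite !linE -sumrB.
  by apply: eq_bigr => j _; rewrite mulrBr.
have sc j : sqint P (fun o => component j b o - component j a o).
  apply: sqintB; first by case: (cK' j b); rewrite ?bT ?(le_trans a0 (ltW ab)).
  by case: (cK' j a); rewrite ?a0 ?(le_trans (ltW ab)).
have Kba : 0 <= K * (b - a) by rewrite mulr_ge0 // subr_ge0 ltW.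
have [s1 s2] := ip_lincomb_le (B i) Kba sc (fun j => cK j a b a0 ab bT).
by split => //; apply: (le_trans s2); rewrite -[leRHS]mulrA ler_wpM2r ?mxsum_row.
Qed.

(** Freezing M x and N x at their values at time a costs, by mean-square
    continuity, a time integral of order (b - a)^(3/2) and a stochastic integral
    of order b - a. *)
Lemma euler_step (T0 : R) : 0 < T0 ->
  exists2 K, 0 <= K & forall i a b, 0 <= a -> a < b -> b <= T0 ->
    exists A J : T -> R,
    [/\ forall o, component i b o = component i a o + A o + J o,
        sqint P (fun o => A o - (b - a) * lin M i a o) /\
        ip P (fun o => A o - (b - a) * lin M i a o)
             (fun o => A o - (b - a) * lin M i a o) <= K * (b - a) ^+ 3,
        sqint P (fun o => J o - lin N i a o * (w b o - w a o)) /\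
        ip P (fun o => J o - lin N i a o * (w b o - w a o))
             (fun o => J o - lin N i a o * (w b o - w a o)) <= K * (b - a) ^+ 2,
        sqint P J &
        forall Z, measurable_wrt (F a) Z -> sqint P Z -> ip P Z J = 0].
Proof.
move=> T00.
have [KM KM0 bM] := lin_increment_bound M T00.
have [KN KN0 bN] := lin_increment_bound N T00.
have [CM _ cM] := lin_bound M T00; have [CN _ cN] := lin_bound N T00.
exists (KM + 4 * KN); first by lra.
move=> i a b a0 ab bT; have ab' := ltW ab; have b0 := le_trans a0 ab'.
have aT := le_trans ab' bT.
have ba0 : 0 < b - a by rewrite subr_gt0.
have [J lJ E] := sde_increment i a0 ab'.
have [_ sJ _] := lJ.
have aT' : 0 <= a <= T0 by rewrite a0.
have [slM _] := cM i a aT'; have [slN _] := cN i a aT'.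
have inc (c k : R) s : 0 <= k -> a < s < b -> c <= k * (s - a) -> c <= k * (b - a).
  move=> k0 /andP[sa sb] /le_trans; apply; rewrite ler_wpM2l //; lra.
exists (fun o => component i b o - component i a o - J o), J; split => //.
- by move=> o; ring.
- pose h := window `]a, b] (fun s o => lin M i s o - lin M i a o).
  have mi : measurable (`]a, b] : set R) by exact: measurable_itv.
  have mh : measurable_fun setT h.
    have -> : h = (fun z => window `]a, b] (lin M i) z -
        lin M i a z.2 * \1_(`]a, b] : set R) z.1).
      by apply/funext => z; rewrite /h /window mulrBl.
    apply: measurable_funB; first by case: (sqint_window_itv M i a0 ab').
    apply: measurable_funM; last exact: measurableT_comp.
    by case: slM => mM _; exact: measurableT_comp.
  have out s o : ~~ (a <= s <= b) -> h (s, o) = 0.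
    move=> /negP sab; apply: window0; rewrite /= in_itv /= => /andP[h1 h2].
    by apply: sab; rewrite (ltW h1) h2.
  have Kba : 0 <= KM * (b - a) by rewrite mulr_ge0 // ltW.
  have slice s : a < s < b ->
      (\int[P]_o (h (s, o) ^+ 2)%:E <= (KM * (b - a))%:E)%E.
    move=> sab; have /andP[sa sb] := sab.
    have [s1 s2] := bM i a s a0 sa (le_trans (ltW sb) bT).
    apply: le_trans (_ : (ip P (fun o => lin M i s o - lin M i a o)
      (fun o => lin M i s o - lin M i a o))%:E <= _)%E; last first.
      by rewrite lee_fin; exact: inc s2.
    rewrite ipE //; rewrite le_eqVlt; apply/orP; left; apply/eqP.
    apply: eq_integral => o _; rewrite /h /window /= indicE mem_set ?mulr1 //=.
    by rewrite in_itv /= sa ltW.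
  have [sh h2] := ip_slices Kba ab mh out slice.
  have [] := @ip_time_integral _ _ _ P h
    (fun o => component i b o - component i a o - J o - (b - a) * lin M i a o)
    a b (b - a) ba0 ab' (lexx _) sh out.
  + apply: measurable_funB; last by apply: measurable_funM => //; case: slM.
    apply: measurable_funB; last by case: sJ.
    apply: measurable_funB; first exact: (adapted_measurable hF b0 (measurable_component i b0)).
    exact: (adapted_measurable hF a0 (measurable_component i a0)).
  + have outc s o : ~~ (a <= s <= b) -> window `]a, b] (lin M i) (s, o) = 0.
      move=> /negP sab; apply: window0; rewrite /= in_itv /= => /andP[h1 h3].
      by apply: sab; rewrite (ltW h1) h3.
    have S := ae_integrable_section (sqint_window_itv M i a0 ab') outc.
    apply: filterS2 E S => o -> So.
    have I1 : leb.-integrable setT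
        (EFin \o (fun s => lin M i a o * \1_(`]a, b] : set R) s)).
      exact/integrable_fZ/integrable_indic_itv.
    rewrite /h; under [RHS]eq_Rintegral do rewrite /window /= mulrBl.
    rewrite [RHS](RintegralB _ So I1) //; congr (_ - _).
    rewrite RintegralZl //; last exact: integrable_indic_itv.
    rewrite mulrC; congr (_ * _); rewrite /Rintegral integral_indic // setIT.
    have -> : b - a = fine (leb (`]a, b] : set R)).
      by rewrite lebesgue_measure_itv /= lte_fin ab.
    by [].
  move=> sA A2; split => //; apply: (le_trans A2).
  rewrite exprS mulrCA ler_pM2l //; apply: (le_trans h2).
  rewrite expr2 mulrA ler_pM2r // ler_pM2r //; lra.
- pose p := Step a b (lin N i a).
  have ap : adapted_step P F p by split => //; exact: measurable_lin.
  pose g z := window `]a, b] (lin N i) z - step_proc p z.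
  have lR : ito_lim P F w g (fun o => J o - step_int w p o).
    have lp := ito_lim_step hF hw ap.
    have := ito_limB hF hw lJ lp.
    exact.
  have [[mg _] sR _] := lR.
  split; first exact: sR.
  apply: (le_trans (ito_lim_bound hF hw lR)).
  have Kba : 0 <= KN * (b - a) by rewrite mulr_ge0 // ltW.
  have out s o : ~~ (a <= s <= b) -> g (s, o) = 0.
    move=> /negP sab; rewrite /g window0; last first.
      rewrite /= in_itv /= => /andP[h1 h2].
      by apply: sab; rewrite (ltW h1) h2.
    rewrite /step_proc /= indicE memNset ?mulr0 ?subrr //= in_itv /=.
    move=> /andP[h1 h2].
    by apply: sab; rewrite h1 ltW.
  have slice s : a < s < b ->
      (\int[P]_o (g (s, o) ^+ 2)%:E <= (KN * (b - a))%:E)%E.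
    move=> sab; have /andP[sa sb] := sab.
    have [s1 s2] := bN i a s a0 sa (le_trans (ltW sb) bT).
    apply: le_trans (_ : (ip P (fun o => lin N i s o - lin N i a o)
      (fun o => lin N i s o - lin N i a o))%:E <= _)%E; last first.
      by rewrite lee_fin; exact: inc s2.
    rewrite ipE //; rewrite le_eqVlt; apply/orP; left; apply/eqP.
    apply: eq_integral => o _; rewrite /g /window /step_proc /= !indicE.
    by rewrite !mem_set ?mulr1 //= in_itv /= ?sa ?(ltW sa) ?sb ?ltW.
  have [_ g2] := ip_slices Kba ab mg out slice.
  apply: (le_trans (_ : _ <= 4 * (KN * (b - a) * (b - a)))).
    by rewrite ler_pM2l.
  rewrite expr2 !mulrA ler_pM2r // ler_pM2r //; lra.
- move=> Z aZ sZ; apply: (ito_lim_orth hF hw a0 aZ sZ _ lJ) => -[s o] /= sa.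
  apply: window0; rewrite /= in_itv /= => /andP[h1 _].
  by have := lt_trans sa h1; rewrite ltxx.
Qed.

End Solution.

(** * One step of the second moment matrix *)

Section MomentStep.
Context {R : realType} {d : measure_display} {T : measurableType d}.
Variables (P : probability T R) (F : R -> set (set T)) (w : R -> T -> R).
Hypotheses (hF : filtration P F) (hw : wiener P F w).
Variables (n : nat) (M N : 'M[R]_n) (x0 : 'cV[R]_n) (x : R -> T -> 'cV[R]_n).
Hypothesis sol : sde_solution P F w M N x0 x.
Implicit Types (s t a b : R) (i j : 'I_n) (B G : 'M[R]_n).

Local Notation X := (component x).
Local Notation L := (lin x).

Definition moment t : 'M[R]_n := \matrix_(i, j) ip P (X i t) (X j t).

Lemma moment_sym t : (moment t)^T = moment t.
Proof. by apply/matrixP => i j; rewrite !mxE ipC. Qed.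

Lemma sqint_component t i : 0 <= t -> sqint P (X i t).
Proof.
move=> t0; have T00 : 0 < t + 1 by rewrite ltr_wpDl.
have [K _ cK] := component_bound hF hw sol T00.
by case: (cK i t) => //; rewrite t0 lerDl /=.
Qed.

Lemma sqint_lin B t i : 0 <= t -> sqint P (L B i t).
Proof.
move=> t0; have T00 : 0 < t + 1 by rewrite ltr_wpDl.
have [K _ cK] := lin_bound hF hw sol B T00.
by case: (cK i t) => //; rewrite t0 lerDl /=.
Qed.

Lemma ip_lin_l B t i (f : T -> R) : 0 <= t -> sqint P f ->
  ip P (L B i t) f = \sum_k B i k * ip P (X k t) f.
Proof.
move=> t0 sf; have sX k := sqint_component k t0.
rewrite (eq_ip P (linE x B i t) (fun=> erefl)).
rewrite ip_suml //; first by apply: eq_bigr => k _; rewrite ipZl.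
by move=> k; exact: sqintZ.
Qed.

Lemma ip_lin_component B t i j : 0 <= t ->
  ip P (L B i t) (X j t) = (B *m moment t) i j.
Proof.
move=> t0; rewrite ip_lin_l //; last exact: sqint_component.
by rewrite mxE; apply: eq_bigr => k _; rewrite !mxE.
Qed.

Lemma ip_component_lin B t i j : 0 <= t ->
  ip P (X i t) (L B j t) = (moment t *m B^T) i j.
Proof.
move=> t0; rewrite ipC ip_lin_component //.
have -> : moment t *m B^T = (B *m moment t)^T by rewrite trmx_mul moment_sym.
by rewrite [RHS]mxE.
Qed.

Lemma ip_lin_lin B t i j : 0 <= t ->
  ip P (L B i t) (L B j t) = (B *m moment t *m B^T) i j.
Proof.
move=> t0; rewrite ip_lin_l //; last exact: sqint_lin.
rewrite -mulmxA mxE; apply: eq_bigr => k _; congr (_ * _).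
exact: ip_component_lin.
Qed.

(** S(t) is an average of matrices x x', hence lies in the dual of the cone of
    positive semidefinite forms. *)
Lemma trace_moment t G : 0 <= t ->
  (forall v : 'cV[R]_n, (v^T *m G *m v) 0 0 <= 0) ->
  \tr (G *m moment t) <= 0.
Proof.
move=> t0 G0; have sX k := sqint_component k t0; have sL k := sqint_lin G k t0.
rewrite /mxtrace (eq_bigr (fun i => ip P (L G i t) (X i t))); last first.
  by move=> i _; rewrite ip_lin_component.
rewrite (sum_ip _ sL sX).2 -oppr_ge0 -mulN1r -RintegralZl //; last first.
  by have [] := sum_ip (index_enum 'I_n) sL sX.
apply: Rintegral_ge0 => o _; rewrite mulN1r oppr_ge0.
apply: le_trans (G0 (x t o)).
rewrite le_eqVlt; apply/orP; left; apply/eqP.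
rewrite -mulmxA mxE; apply: eq_bigr => i _.
by rewrite mulrC mxE.
Qed.

Lemma expectation_enorm t : 0 <= t ->
  ('E_P[fun o => (enorm (x t o) ^+ 2)%R] = (\tr (moment t))%:E)%E.
Proof.
move=> t0; have sX k := sqint_component k t0.
have [I E] := sum_ip (index_enum 'I_n) sX sX.
have -> : \tr (moment t) = \sum_i ip P (X i t) (X i t).
  by apply: eq_bigr => i _; rewrite mxE.
rewrite E /Rintegral fineK; last exact: integrable_fin_num I.
rewrite unlock; apply: eq_integral => o _; congr EFin.
rewrite /enorm sqr_sqrtr; last by apply: sumr_ge0 => i _; exact: sqr_ge0.
by apply: eq_bigr => i _; rewrite expr2.
Qed.

Lemma moment_initial : moment 0 = x0 *m x0^T.
Proof.
apply/matrixP => i j; rewrite !mxE (initial_moment hF hw sol).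
by rewrite big_ord1 mxE.
Qed.

Lemma ip_diffusion a b i j : 0 <= a -> a <= b ->
  ip P (fun o => L N i a o * (w b o - w a o))
       (fun o => L N j a o * (w b o - w a o)) =
  (b - a) * ip P (L N i a) (L N j a).
Proof.
move=> a0 ab; have sF := filtration_sigma_algebra hF a0.
have aN k := measurable_lin hF sol N k a0.
have aNN : measurable_wrt (F a) (fun o => L N i a o * L N j a o).
  exact: (measurable_wrtM sF).
have INN := integrable_mul (sqint_lin N i a0) (sqint_lin N j a0).
have [_ E] := integrable_mul_increment_sqr hF hw a0 ab aNN INN.
rewrite mulrC -[RHS]E; apply: eq_Rintegral => o _; ring.
Qed.

(** Expansion of E[x x'] along [euler_step].  The error of J is of the same order
    as the drift, but it appears only multiplied by J or by other small terms,
    since products of J with variables known at time a have mean zero. *)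
Lemma moment_step (T0 : R) : 0 < T0 ->
  exists2 C, 0 <= C & forall a b, 0 <= a -> a < b -> b <= T0 -> b - a <= 1 ->
  forall i j, `|moment b i j - (moment a + (b - a) *:
    (M *m moment a + moment a *m M^T + N *m moment a *m N^T)) i j| <=
    C * ((b - a) * Num.sqrt (b - a)).
Proof.
move=> T00.
have [K K0 eK] := euler_step hF hw sol T00.
have [CX CX0 bX] := component_bound hF hw sol T00.
have [CM CM0 bM] := lin_bound hF hw sol M T00.
have [CN CN0 bN] := lin_bound hF hw sol N T00.
pose C := 2 * CX + 2 * CM + 2 * CN + 2 * K.
have C0 : 0 <= C by rewrite /C; lra.
have CMC : CM <= C by rewrite /C; lra.
have CNC : CN <= C by rewrite /C; lra.
have KC : K <= C by rewrite /C; lra.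
exists (9 * C); first by lra.
move=> a b a0 ab bT ba1 i j.
have ab' := ltW ab; have b0 := le_trans a0 ab'; have aT := le_trans ab' bT.
have aT' : 0 <= a <= T0 by rewrite a0.
set h := b - a; have h0 : 0 < h by rewrite /h subr_gt0.
pose r := Num.sqrt h; have r0 : 0 < r by rewrite sqrtr_gt0.
have hr : h = r ^+ 2 by rewrite sqr_sqrtr // ltW.
have r1 : r <= 1 by rewrite -[leRHS]sqrtr1; exact: ler_wsqrtr.
have r2 := exprn_ge0 2 (ltW r0).
have [Ai [Ji [Ei [sRi Ri] [sQi Qi] sJi orthi]]] := eK i a b a0 ab bT.
have [Aj [Jj [Ej [sRj Rj] [sQj Qj] sJj orthj]]] := eK j a b a0 ab bT.
rewrite -/h in sRi Ri Qi sRj Rj Qj.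
set R_i := (fun o => Ai o - _) in sRi Ri; set R_j := (fun o => Aj o - _) in sRj Rj.
set Q_i := (fun o => Ji o - _) in sQi Qi; set Q_j := (fun o => Jj o - _) in sQj Qj.
(* x_b = U + R + J and J = V + Q, where U is known at time a, and R and Q are
   the errors of sizes r^3 and r^2. *)
pose V k o := L N k a o * (w b o - w a o).
pose U k o := X k a o + h * L M k a o.
have sF := filtration_sigma_algebra hF a0.
have aX k : measurable_wrt (F a) (X k a) by exact: (measurable_component sol).
have aU k : measurable_wrt (F a) (U k).
  apply: (measurable_wrtD sF) => //; apply: (measurable_wrtM sF).
    exact: measurable_wrt_cst.
  exact: (measurable_lin hF sol).
have sX k := sqint_component k a0; have sM k := sqint_lin M k a0.
have shM k : sqint P (fun o => h * L M k a o) by exact: sqintZ.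
have sU k : sqint P (U k) by exact: sqintD.
have sVi : sqint P (V i).
  by apply: eq_sqint (sqintB sJi sQi) => o; rewrite /Q_i /V; ring.
have sVj : sqint P (V j).
  by apply: eq_sqint (sqintB sJj sQj) => o; rewrite /Q_j /V; ring.
have UJ : ip P (U i) Jj = 0 by exact: orthj.
have JU : ip P Ji (U j) = 0 by rewrite ipC; exact: orthi.
have bU k : ip P (U k) (U k) <= C * r ^+ 0 ^+ 2.
  apply: (le_trans (ip_sqrD (sX k) (shM k))).
  rewrite ipZl // ipZr // expr0 expr1n mulr1.
  have [_ h1] := bX k a aT'; have [_ h2] := bM k a aT'.
  have hh : h * (h * ip P (L M k a) (L M k a)) <= CM.
    rewrite mulrA; apply: le_trans h2; apply: ler_piMl; first exact: ip_ge0.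
    by rewrite mulr_ile1 // ltW.
  by rewrite /C; lra.
have bV k : ip P (V k) (V k) <= CN * r ^+ 2.
  rewrite ip_diffusion // -/h hr mulrC ler_wpM2r //.
  by have [_] := bN k a aT'.
have r22 : r ^+ 2 ^+ 2 <= r ^+ 2.
  by rewrite -exprM ler_wiXn2l // ltW.
have bR f : ip P f f <= K * h ^+ 3 -> ip P f f <= C * r ^+ 3 ^+ 2.
  move=> /le_trans; apply; rewrite hr -!exprM.
  by apply: ler_wpM2r => //; exact: exprn_ge0 (ltW r0).
have bQ f : ip P f f <= K * h ^+ 2 -> ip P f f <= C * r ^+ 2 ^+ 2.
  move=> /le_trans; apply; rewrite hr -!exprM.
  by apply: ler_wpM2r => //; exact: exprn_ge0 (ltW r0).
have bJ k J Q : sqint P (V k) -> sqint P Q -> (fun o => J o - V k o) = Q ->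
    ip P Q Q <= K * h ^+ 2 -> ip P J J <= C * r ^+ 1 ^+ 2.
  move=> sV sQ JQ qK; have := ip_sqrD sV sQ.
  have -> : (fun o => V k o + Q o) = J by apply/funext => o; rewrite -JQ; ring.
  move=> /le_trans; apply; rewrite expr1.
  have := bV k; rewrite hr in qK; have := ler_wpM2l K0 r22.
  have := mulr_ge0 CX0 r2; have := mulr_ge0 CM0 r2.
  by rewrite /C; lra.
have bJi := bJ i Ji Q_i sVi sQi erefl Qi.
have bJj := bJ j Jj Q_j sVj sQj erefl Qj.
have bVC k : ip P (V k) (V k) <= C * r ^+ 1 ^+ 2.
  by apply: (le_trans (bV k)); rewrite expr1 ler_wpM2r.
have cross p q f g : (3 <= p + q)%N -> sqint P f -> sqint P g ->
    ip P f f <= C * r ^+ p ^+ 2 -> ip P g g <= C * r ^+ q ^+ 2 ->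
    `|ip P f g| <= C * r ^+ 3.
  move=> pq sf sg hf hg.
  exact: (ip_power_bound C0 (ltW r0) r1 pq sf sg hf hg).
have c1 := cross 0%N 3%N _ _ isT (sU i) sRj (bU i) (bR _ Rj).
have c2 := cross 3%N 0%N _ _ isT sRi (sU j) (bR _ Ri) (bU j).
have c3 := cross 3%N 3%N _ _ isT sRi sRj (bR _ Ri) (bR _ Rj).
have c4 := cross 3%N 1%N _ _ isT sRi sJj (bR _ Ri) bJj.
have c5 := cross 1%N 3%N _ _ isT sJi sRj bJi (bR _ Rj).
have c6 := cross 1%N 2%N _ _ isT sVi sQj (bVC i) (bQ _ Qj).
have c7 := cross 2%N 1%N _ _ isT sQi sVj (bQ _ Qi) (bVC j).
have c8 := cross 2%N 2%N _ _ isT sQi sQj (bQ _ Qi) (bQ _ Qj).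
have bm k : ip P (fun o => h * L M k a o) (fun o => h * L M k a o) <=
    C * r ^+ 2 ^+ 2.
  rewrite ipZl // ipZr // mulrA -expr2 hr mulrC ler_wpM2r ?sqr_ge0 //.
  by have [_ /le_trans] := bM k a aT'; apply.
have c9 := cross 2%N 2%N _ _ isT (shM i) (shM j) (bm i) (bm j).
have JJ : ip P Ji Jj = h * ip P (L N i a) (L N j a) +
    (ip P (V i) Q_j + ip P Q_i (V j) + ip P Q_i Q_j).
  rewrite -(ip_diffusion i j a0 ab') -/(V i) -/(V j).
  have -> : ip P Ji Jj = ip P (fun o => V i o + Q_i o) (fun o => V j o + Q_j o).
    by apply: eq_ip => o; rewrite /V /Q_i /Q_j; ring.
  have sVQ := sqintD sVj sQj.
  by rewrite (ipDl sVi sQi sVQ) (ipDr sVj sQj sVi) (ipDr sVj sQj sQi); ring.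
have UU : ip P (U i) (U j) = ip P (X i a) (X j a) +
    h * (ip P (L M i a) (X j a) + ip P (X i a) (L M j a)) +
    ip P (fun o => h * L M i a o) (fun o => h * L M j a o).
  rewrite (ipDl (sX i) (shM i) (sU j)) (ipDr (sX j) (shM j) (sX i)).
  rewrite (ipDr (sX j) (shM j) (shM i)) (ipZl h (sM i) (sX j)).
  by rewrite (ipZr h (sM j) (sX i)); ring.
have XX : ip P (X i b) (X j b) = ip P (U i) (U j) + ip P (U i) R_j +
    ip P R_i (U j) + ip P R_i R_j + ip P R_i Jj + ip P Ji R_j + ip P Ji Jj.
  have -> : ip P (X i b) (X j b) =
      ip P (fun o => (U i o + R_i o) + Ji o) (fun o => (U j o + R_j o) + Jj o).
    by apply: eq_ip => o; rewrite ?Ei ?Ej /U /R_i /R_j; ring.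
  have sUi := sqintD (sU i) sRi; have sUj := sqintD (sU j) sRj.
  have sXj := sqintD sUj sJj.
  rewrite (ipDl sUi sJi sXj) (ipDr sUj sJj sUi) (ipDr sUj sJj sJi).
  rewrite (ipDl (sU i) sRi sUj) (ipDl (sU i) sRi sJj).
  rewrite (ipDr (sU j) sRj (sU i)) (ipDr (sU j) sRj sRi) (ipDr (sU j) sRj sJi).
  by rewrite UJ JU; ring.
have -> : moment b i j - (moment a + h *:
    (M *m moment a + moment a *m M^T + N *m moment a *m N^T)) i j =
  ip P (U i) R_j + ip P R_i (U j) + ip P R_i R_j + ip P R_i Jj + ip P Ji R_j +
  (ip P (V i) Q_j + ip P Q_i (V j) + ip P Q_i Q_j) +
  ip P (fun o => h * L M i a o) (fun o => h * L M j a o).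
  rewrite [moment b i j]mxE XX UU JJ ip_lin_component // ip_component_lin //.
  rewrite ip_lin_lin //.
  have entryD (G H : 'M[R]_n) : (G + H) i j = G i j + H i j by rewrite mxE.
  have entryZ (G : 'M[R]_n) : (h *: G) i j = h * G i j by rewrite mxE.
  by rewrite entryD entryZ !entryD [moment a i j]mxE; ring.
have -> : h * Num.sqrt h = r ^+ 3 by rewrite -/r {1}hr; ring.
have -> : 9 * C * r ^+ 3 = C * r ^+ 3 + C * r ^+ 3 + C * r ^+ 3 + C * r ^+ 3 +
    C * r ^+ 3 + (C * r ^+ 3 + C * r ^+ 3 + C * r ^+ 3) + C * r ^+ 3 by ring.
by do !(apply: (le_trans (ler_normD _ _)); apply: lerD => //).
Qed.

End MomentStep.

(** * Accumulating the errors of many small steps *)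

(** Bernoulli's inequality: (1 + u)^k <= 1 / (1 - k u) when k u < 1. *)
Lemma compound_le (R : realFieldType) (u : R) k : 0 <= u ->
  (1 + u) ^+ k * (1 - k%:R * u) <= 1.
Proof.
move=> u0; elim: k => [|k IH]; first by rewrite expr0 mul0r subr0 mul1r.
apply: le_trans IH; rewrite exprSr -mulrA; apply: ler_wpM2l.
  by rewrite exprn_ge0 // addr_ge0.
have := mulr_ge0 (ler0n R k) (mulr_ge0 u0 u0); have := mulr_ge0 u0 u0.
by rewrite -natr1; lra.
Qed.

(** N steps of length t / N multiply c + 1 by (1 + u)^N with
    u = C (t / N)^(3/2), and N u tends to 0. *)
Lemma euler_gronwall (R : realType) (B : R -> R -> Prop) (t C c0 e : R) :
  0 <= t -> 0 <= C -> 0 <= c0 -> 0 < e ->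
  (forall s c c', c <= c' -> B s c -> B s c') ->
  (forall a b c, 0 <= a -> a < b -> b <= t -> b - a <= 1 -> 0 <= c -> B a c ->
     B b (c + C * (c + 1) * ((b - a) * Num.sqrt (b - a)))) ->
  B 0 c0 -> B t (c0 + e).
Proof.
move=> t0 C0 c00 e0 mono step B0.
move: t0; rewrite le_eqVlt => /predU1P[<-|t0].
  by apply: mono B0; rewrite lerDl ltW.
(* N u <= eta will give a growth factor 1 / (1 - eta) = (c0 + 1 + e) / (c0 + 1). *)
pose eta := e / (c0 + 1 + e).
have D0 : 0 < c0 + 1 + e by lra.
have eta0 : 0 < eta by rewrite divr_gt0.
(* Any N > y makes t / N at most 1 and the accumulated error N u at most eta. *)
pose y := t + (C * t) ^+ 2 * t / eta ^+ 2.
have y2 : 0 <= (C * t) ^+ 2 * t / eta ^+ 2.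
  apply: divr_ge0; last exact: sqr_ge0.
  by apply: mulr_ge0; [exact: sqr_ge0|exact: ltW].
have y0 : 0 <= y by rewrite /y; lra.
pose N := Num.bound y.
have yN : y < N%:R by exact: archi_boundP.
have N0 : 0 < (N%:R : R) by exact: le_lt_trans yN.
pose h := t / N%:R.
have h0 : 0 < h by rewrite divr_gt0.
have h1 : h <= 1 by rewrite ler_pdivrMr // mul1r; move: yN; rewrite /y; lra.
have Nh : N%:R * h = t by rewrite mulrC divfK // gt_eqF.
pose u := C * (h * Num.sqrt h).
have u0 : 0 <= u by rewrite !mulr_ge0 // ?sqrtr_ge0 // ltW.
have Nu : N%:R * u <= eta.
  have eta0' := ltW eta0; have Nu0 : 0 <= N%:R * u by rewrite mulr_ge0.
  rewrite -(@ler_pXn2r _ 2) ?nnegrE //.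
  have -> : (N%:R * u) ^+ 2 = (C * (N%:R * h)) ^+ 2 * Num.sqrt h ^+ 2.
    by rewrite /u; ring.
  rewrite (sqr_sqrtr (ltW h0)) Nh /h mulrA ler_pdivrMr // [leRHS]mulrC -ler_pdivrMr ?exprn_gt0 //.
  by move: yN; rewrite /y; lra.
have iter k : (k <= N)%N -> B (k%:R * h) ((c0 + 1) * (1 + u) ^+ k - 1).
  elim: k => [_|k IH kN].
    by rewrite mul0r expr0 mulr1 addrK.
  have := step (k%:R * h) (k.+1%:R * h) ((c0 + 1) * (1 + u) ^+ k - 1).
  have -> : k.+1%:R * h - k%:R * h = h by rewrite -natr1; ring.
  have -> : (c0 + 1) * (1 + u) ^+ k - 1 +
    C * ((c0 + 1) * (1 + u) ^+ k - 1 + 1) * (h * Num.sqrt h) =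
    (c0 + 1) * (1 + u) ^+ k.+1 - 1 by rewrite exprS /u; ring.
  apply => //.
  - by rewrite mulr_ge0 // ltW.
  - by rewrite ltr_pM2r // ltr_nat.
  - by rewrite -Nh ler_pM2r // ler_nat.
  - have : 1 <= (1 + u) ^+ k by rewrite exprn_ege1 // lerDl.
    by move=> /(ler_wpM2l (_ : 0 <= c0 + 1)); rewrite mulr1; lra.
  - exact: IH (ltnW kN).
have := iter N (leqnn N); rewrite Nh; apply: mono.
have comp := compound_le N u0.
have {}comp : (1 + u) ^+ N * (1 - eta) <= 1.
  apply: le_trans comp; rewrite ler_wpM2l ?exprn_ge0 ?addr_ge0 //.
  by rewrite lerB.
have etaE : 1 - eta = (c0 + 1) / (c0 + 1 + e).
  by rewrite /eta; field; rewrite gt_eqF.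
move: comp; rewrite etaE mulrA ler_pdivrMr // mul1r mulrC; lra.
Qed.

(** * Quadratic forms *)

Section QuadraticForms.
Context {R : realType} {n : nat}.
Implicit Types (Q S E G B : 'M[R]_n) (u v : 'cV[R]_n).

Definition bil Q u v : R := (u^T *m Q *m v) 0 0.
Local Notation quad Q v := (bil Q v v).

Lemma bilE Q u v : bil Q u v = \sum_i \sum_j u i 0 * Q i j * v j 0.
Proof.
rewrite /bil mxE exchange_big; apply: eq_bigr => j _ /=.
by rewrite mxE mulr_suml; apply: eq_bigr => i _; rewrite mxE.
Qed.

Lemma mxBE Q S i j : (Q - S) i j = Q i j - S i j.
Proof. by rewrite mxE [(- S) i j]mxE. Qed.

Lemma bilDm Q S u v : bil (Q + S) u v = bil Q u v + bil S u v.
Proof. by rewrite /bil mulmxDr mulmxDl mxE. Qed.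

Lemma bilZm a Q u v : bil (a *: Q) u v = a * bil Q u v.
Proof. by rewrite /bil -scalemxAr -scalemxAl mxE. Qed.

Lemma bilNm Q u v : bil (- Q) u v = - bil Q u v.
Proof. by rewrite -scaleN1r bilZm mulN1r. Qed.

Lemma bil_congr B Q v : quad (B *m Q *m B^T) v = quad Q (B^T *m v).
Proof. by rewrite /bil trmx_mul trmxK !mulmxA. Qed.

Lemma bilDl Q u u' v : bil Q (u + u') v = bil Q u v + bil Q u' v.
Proof. by rewrite /bil linearD !mulmxDl mxE. Qed.

Lemma bilZl a Q u v : bil Q (a *: u) v = a * bil Q u v.
Proof. by rewrite /bil linearZ /= -!scalemxAl mxE. Qed.

Lemma bilDr Q u v v' : bil Q u (v + v') = bil Q u v + bil Q u v'.
Proof. by rewrite /bil mulmxDr mxE. Qed.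

Lemma bilZr a Q u v : bil Q u (a *: v) = a * bil Q u v.
Proof. by rewrite /bil -scalemxAr mxE. Qed.

Lemma bil_tr Q u v : bil Q u v = bil Q^T v u.
Proof.
by rewrite /bil -[RHS]trace_mx11 -mxtrace_tr !trmx_mul !trmxK mulmxA trace_mx11.
Qed.

Lemma quad_trace Q v : quad Q v = \tr (v *m v^T *m Q).
Proof. by rewrite /bil -trace_mx11 mxtrace_mulC mulmxA. Qed.

Lemma quad_abs_le E e v : (forall i j, `|E i j| <= e) ->
  `|quad E v| <= e * \sum_i \sum_j (v i 0 ^+ 2 + v j 0 ^+ 2).
Proof.
move=> Ee; rewrite bilE mulr_sumr.
apply: (le_trans (ler_norm_sum _ _ _)); apply: ler_sum => i _.
rewrite mulr_sumr; apply: (le_trans (ler_norm_sum _ _ _)); apply: ler_sum => j _.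
rewrite !normrM mulrAC mulrC.
have vv : `|v i 0| * `|v j 0| <= v i 0 ^+ 2 + v j 0 ^+ 2.
  rewrite -(real_normK (num_real (v i 0))) -(real_normK (num_real (v j 0))).
  by have := normr_ge0 (v i 0); have := normr_ge0 (v j 0); nra.
apply: ler_pM => //; exact: mulr_ge0.
Qed.

Lemma trace_abs_le G E e : (forall i j, `|E i j| <= e) ->
  `|\tr (G *m E)| <= mxsum G * e.
Proof.
move=> Ee; rewrite /mxtrace /mxsum mulr_suml.
apply: (le_trans (ler_norm_sum _ _ _)); apply: ler_sum => i _.
rewrite mxE mulr_suml; apply: (le_trans (ler_norm_sum _ _ _)).
by apply: ler_sum => j _; rewrite normrM ler_wpM2l.
Qed.

Lemma mxsum_ge0 G : 0 <= mxsum G.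
Proof. by apply: sumr_ge0 => i _; apply: sumr_ge0. Qed.

Section Posdef.
Variable Q : 'M[R]_n.
Hypothesis pQ : posdef Q.

Lemma posdef_ge0 v : 0 <= quad Q v.
Proof.
have [->|v0] := eqVneq v 0; last by apply: ltW; case: pQ => _ /(_ v v0).
by rewrite /bil mulmx0 mxE.
Qed.

Lemma posdef_cauchy_schwarz u v : bil Q u v ^+ 2 <= quad Q u * quad Q v.
Proof.
have [sQ Qpos] := pQ.
have [->|v0] := eqVneq v 0.
  by rewrite /bil !mulmx0 !mxE expr0n mulr0.
have qv : 0 < quad Q v by exact: Qpos.
set b := bil Q u v.
have bC : bil Q v u = b by rewrite bil_tr sQ.
have := posdef_ge0 (quad Q v *: u + (- b) *: v).
rewrite !(bilDl, bilDr, bilZl, bilZr) bC -/b.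
set qu := quad Q u; set q := quad Q v.
have -> : q * (q * qu + - b * b) + (q * (- b * b) + - b * (- b * q)) =
  q * (qu * q - b ^+ 2) by ring.
by rewrite pmulr_rge0 // subr_ge0.
Qed.

Lemma posdef_unitmx : Q \in unitmx.
Proof.
have [sQ Qpos] := pQ.
rewrite -row_free_unit -kermx_eq0; apply/rowV0P => v /sub_kermxP vQ.
apply/eqP; apply/negPn/negP => v0.
have vT0 : v^T != 0 by rewrite -(inj_eq trmx_inj) trmxK trmx0.
by have := Qpos _ vT0; rewrite trmxK vQ mul0mx mxE ltxx.
Qed.

(** In the inner product defined by Q, the coordinate v_i is the product of v with
    Q^-1 e_i, so Cauchy-Schwarz bounds it.  This takes the place of a smallest
    eigenvalue. *)
Lemma posdef_entry i : exists2 c, 0 <= c & forall v, v i 0 ^+ 2 <= c * quad Q v.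
Proof.
have [sQ _] := pQ.
pose u : 'cV[R]_n := invmx Q *m delta_mx i 0.
exists (quad Q u); first exact: posdef_ge0.
move=> v; have -> : v i 0 = bil Q u v; last exact: posdef_cauchy_schwarz.
rewrite /bil /u trmx_mul trmx_inv sQ -(mulmxA _ (invmx Q)) (mulVmx posdef_unitmx).
rewrite mulmx1 mxE (bigD1 i) //= !mxE !eqxx mul1r big1 ?addr0 // => j ji.
by rewrite !mxE (negbTE ji) mul0r.
Qed.

(** A form with small entries is dominated by Q; applied to error matrices, to
    M Q M', to the identity and to x0 x0'. *)
Lemma quad_le_posdef : exists2 k, 0 <= k & forall E e v,
  0 <= e -> (forall i j, `|E i j| <= e) -> `|quad E v| <= k * e * quad Q v.
Proof.
have ex i : exists c, 0 <= c /\ forall v, v i 0 ^+ 2 <= c * quad Q v.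
  by have [c] := posdef_entry i; exists c.
have [c cP] := fin_all_exists ex.
exists (\sum_i \sum_j (c i + c j)).
  by apply: sumr_ge0 => i _; apply: sumr_ge0 => j _; rewrite addr_ge0 ?(cP _).1.
move=> E e v e0 Ee; apply: (le_trans (quad_abs_le v Ee)).
rewrite [_ * e]mulrC -mulrA ler_wpM2l // mulr_suml; apply: ler_sum => i _.
rewrite mulr_suml; apply: ler_sum => j _.
by rewrite mulrDl lerD // (cP _).2.
Qed.

End Posdef.
End QuadraticForms.

(** * Second moments stay bounded *)

Section MomentFlow.
Context {R : realType} {n : nat}.
Variables (M N : 'M[R]_n) (S0 : 'M[R]_n) (S : R -> 'M[R]_n).
Implicit Types (Q G E : 'M[R]_n) (v : 'cV[R]_n) (s t a b c e : R).

(** The right-hand side of the equation satisfied by second moments. *)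
Definition generator Q : 'M[R]_n := M *m Q + Q *m M^T + N *m Q *m N^T.

Hypothesis S_init : S 0 = S0.
Hypothesis S_psd : forall t G, 0 <= t -> (forall v, bil G v v <= 0) ->
  \tr (G *m S t) <= 0.
Hypothesis S_step : forall T0, 0 < T0 -> exists2 C, 0 <= C &
  forall a b, 0 <= a -> a < b -> b <= T0 -> b - a <= 1 ->
  forall i j, `|S b i j - (S a + (b - a) *: generator (S a)) i j| <=
    C * ((b - a) * Num.sqrt (b - a)).

Lemma S_ge0 t v : 0 <= t -> 0 <= bil (S t) v v.
Proof.
move=> t0; rewrite quad_trace.
have := @S_psd t (- (v *m v^T)) t0.
rewrite mulNmx linearN /= oppr_le0; apply => u; rewrite bilNm oppr_le0.
have -> : bil (v *m v^T) u u = (v^T *m u) 0 0 ^+ 2; last exact: sqr_ge0.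
rewrite /bil !mulmxA -mulmxA mxE big_ord1 expr2; congr (_ * _).
by rewrite -[u^T *m v]trmxK mxE trmx_mul trmxK.
Qed.

(** The operator of condition 1 is the adjoint, for the trace pairing, of the
    operator of condition 2. *)
Lemma trace_generator Q G :
  \tr (Q *m generator G) =
  \tr ((Q *m M + M^T *m Q + N^T *m Q *m N) *m G).
Proof.
rewrite /generator !mulmxDr !mulmxDl !mxtraceD; congr (_ + _ + _).
- by rewrite mulmxA.
- by rewrite mulmxA mxtrace_mulC mulmxA.
- by rewrite !mulmxA mxtrace_mulC !mulmxA.
Qed.

Lemma lyapunov_bound Q t e c : 0 <= t -> 0 < e -> 0 <= c ->
  (forall v, bil (Q *m M + M^T *m Q + N^T *m Q *m N) v v <= 0) ->
  \tr (Q *m S0) <= c -> \tr (Q *m S t) <= c + e.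
Proof.
move=> t0 e0 c0 LQ Qc.
have T00 : 0 < t + 1 by rewrite ltr_wpDl.
have [C C0 hC] := S_step T00.
pose B s c' := \tr (Q *m S s) <= c'.
apply: (@euler_gronwall _ B t (mxsum Q * C)) => //.
- by rewrite mulr_ge0 // mxsum_ge0.
- by move=> s c1 c2 c12 /le_trans; apply.
- move=> a b c1 a0 ab bt ba1 c10; rewrite /B => Ba.
  have bT : b <= t + 1 by apply: (le_trans bt); rewrite lerDl.
  set r := _ * Num.sqrt _.
  have r0 : 0 <= r by rewrite mulr_ge0 ?sqrtr_ge0 // subr_ge0 ltW.
  pose E := S b - (S a + (b - a) *: generator (S a)).
  have Ee i j : `|E i j| <= C * r.
    by have := hC a b a0 ab bT ba1 i j; rewrite /E mxBE.
  have -> : S b = S a + (b - a) *: generator (S a) + E.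
    by rewrite /E addrC subrK.
  clearbody E; rewrite !mulmxDr !mxtraceD -scalemxAr mxtraceZ trace_generator.
  have h1 := le_trans (ler_norm _) (trace_abs_le Q Ee).
  have h2 : (b - a) * \tr ((Q *m M + M^T *m Q + N^T *m Q *m N) *m S a) <= 0.
    by rewrite pmulr_rle0 ?subr_gt0 //; exact: S_psd.
  have h3 := mulr_ge0 (mulr_ge0 (mulr_ge0 (mxsum_ge0 Q) C0) c10) r0.
  by move: h1 h3; rewrite mulrA; lra.
- by rewrite /B S_init.
Qed.

(** The inequality S <= c Q survives an Euler step: the positive part of the step
    is monotone in S, the term - h^2 M S M' has the good sign for S, and for c Q
    it costs only O(h^2). *)
Lemma dual_lyapunov_bound Q t e c v : posdef Q -> 0 <= t -> 0 < e -> 0 <= c ->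
  (forall u, bil (generator Q) u u <= 0) ->
  (forall u, bil S0 u u <= c * bil Q u u) ->
  bil (S t) v v <= (c + e) * bil Q v v.
Proof.
move=> pQ t0 e0 c0 LQ Qc.
have T00 : 0 < t + 1 by rewrite ltr_wpDl.
have [C C0 hC] := S_step T00.
have [k k0 hk] := quad_le_posdef pQ.
pose m := mxsum (M *m Q *m M^T).
have m0 : 0 <= m by exact: mxsum_ge0.
have mb i j : `|(M *m Q *m M^T) i j| <= m.
  rewrite /m /mxsum (bigD1 i) //= (bigD1 j) //= -addrA lerDl addr_ge0 //.
    by apply: sumr_ge0.
  by apply: sumr_ge0 => i' _; apply: sumr_ge0.
pose B s c' := forall u, bil (S s) u u <= c' * bil Q u u.
suff : B t (c + e) by apply.
apply: (@euler_gronwall _ B t (k * m + k * C)) => //.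
- by rewrite addr_ge0 // mulr_ge0.
- move=> s c1 c2 c12 Bs u; apply: (le_trans (Bs u)).
  by rewrite ler_wpM2r // posdef_ge0.
- move=> a b c1 a0 ab bt ba1 c10 Ba u.
  have bT : b <= t + 1 by apply: (le_trans bt); rewrite lerDl.
  set h := b - a; have h0 : 0 < h by rewrite subr_gt0.
  have ba1' : h <= 1 by [].
  set r := _ * Num.sqrt _.
  have r0 : 0 <= r by rewrite mulr_ge0 ?sqrtr_ge0 // ltW.
  have hr : h ^+ 2 <= r.
    rewrite expr2 /r ler_pM2l // -{1}(sqr_sqrtr (ltW h0)) expr2.
    rewrite ler_piMl ?sqrtr_ge0 // -[leRHS]sqrtr1.
    exact: ler_wsqrtr.
  pose E := S b - (S a + h *: generator (S a)).
  have Ee i j : `|E i j| <= C * r.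
    by have := hC a b a0 ab bT ba1 i j; rewrite /E mxBE.
  have Cr : 0 <= C * r by rewrite mulr_ge0.
  (* The Euler step, completed to a congruence. *)
  have euler G : G + h *: generator G =
      (1%:M + h *: M) *m G *m (1%:M + h *: M)^T + h *: (N *m G *m N^T) -
      h ^+ 2 *: (M *m G *m M^T).
    have -> : (1%:M + h *: M)^T = 1%:M + h *: M^T.
      by rewrite linearD linearZ /= trmx1.
    rewrite /generator !mulmxDl !mulmxDr !mul1mx !mulmx1 -!scalemxAl -!scalemxAr.
    rewrite !scalerDr !scalerA expr2 -!addrA; congr (_ + _).
    rewrite [RHS]addrCA; congr (_ + _); congr (_ + _).
    by rewrite [RHS]addrCA subrr addr0.
  have split_S : S b = S a + h *: generator (S a) + E by rewrite /E addrC subrK.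
  clearbody E; rewrite split_S bilDm euler !bilDm bilNm !bilZm !bil_congr.
  set z1 := (1%:M + h *: M)^T *m u; set z2 := N^T *m u; set z3 := M^T *m u.
  have q1 := Ba z1; have q2 := Ba z2; have q3 : 0 <= h ^+ 2 * bil (S a) z3 z3.
    by rewrite mulr_ge0 ?sqr_ge0 // S_ge0.
  have qE := le_trans (ler_norm _) (hk E (C * r) u Cr Ee).
  have qM := le_trans (ler_norm _) (hk _ m u m0 mb).
  rewrite bil_congr -/z3 in qM.
  have qQ : bil Q z1 z1 + h * bil Q z2 z2 - h ^+ 2 * bil Q z3 z3 =
      bil Q u u + h * bil (generator Q) u u.
    have := congr1 (fun G => bil G u u) (euler Q).
    move: (generator Q) => g /=.
    by rewrite !bilDm bilNm !bilZm !bil_congr => ->.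
  have LQu : h * bil (generator Q) u u <= 0 by rewrite pmulr_rle0.
  have Q0 := posdef_ge0 pQ u.
  set q := bil Q u u in Q0 qE qM qQ LQu *.
  have q2' := ler_wpM2l (ltW h0) q2.
  have step1 : bil (S a) z1 z1 + h * bil (S a) z2 z2 <=
      c1 * (q + h ^+ 2 * (k * m * q)).
    have g1 : bil Q z1 z1 + h * bil Q z2 z2 <= q + h ^+ 2 * (k * m * q).
      by have := ler_wpM2l (sqr_ge0 h) qM; lra.
    by have := ler_wpM2l c10 g1; lra.
  have step2 : h ^+ 2 * (k * m * q) <= r * (k * m * q).
    by rewrite ler_wpM2r // !mulr_ge0.
  have step3 := ler_wpM2l c10 step2.
  have p1 := mulr_ge0 (mulr_ge0 (mulr_ge0 k0 m0) r0) Q0.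
  have p2 := mulr_ge0 (mulr_ge0 (mulr_ge0 (mulr_ge0 k0 C0) r0) Q0) c10.
  move: step1 step3 qE p1 p2 q3; lra.
- by move=> u; rewrite S_init; exact: Qc.
Qed.

End MomentFlow.

(** * Two-stability from the matrix inequalities *)

Section Stability.
Context {R : realType} {d : measure_display} {T : measurableType d}.
Variables (P : probability T R) (F : R -> set (set T)) (w : R -> T -> R).
Hypotheses (hF : filtration P F) (hw : wiener P F w).
Context {n : nat}.
Implicit Types (M N Q : 'M[R]_n).

(** The slack e is chosen as a multiple of eps, after which delta is a multiple of
    the square root of eps. *)
Lemma two_stable_of_moment_bound M N (k : R) : 0 <= k ->
  (forall x0 x, sde_solution P F w M N x0 x ->
     forall t e, 0 <= t -> 0 < e ->
       \tr (moment P x t) <= k * (enorm x0 ^+ 2 + e)) ->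
  two_stable P F w M N.
Proof.
move=> k0 bound eps eps0.
have k2 : 0 < 2 * (k + 1) by lra.
exists (Num.sqrt (eps / (2 * (k + 1)))); first by rewrite sqrtr_gt0 divr_gt0.
move=> x0 x sol t t0 x0d.
rewrite (expectation_enorm hF hw sol t0) lte_fin.
set e := eps / (2 * (k + 1)) in x0d *.
have e0 : 0 < e by rewrite divr_gt0.
have xe : enorm x0 ^+ 2 <= e.
  rewrite -(sqr_sqrtr (ltW e0)) lerXn2r ?nnegrE ?sqrtr_ge0 //.
  exact: ltW.
apply: (le_lt_trans (bound x0 x sol t e t0 e0)).
have : k * (enorm x0 ^+ 2 + e) <= k * (e + e) by rewrite ler_wpM2l // lerD2r.
move=> /le_lt_trans; apply.
have -> : eps = 2 * (k + 1) * e by rewrite /e mulrC divfK // gt_eqF.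
lra.
Qed.

Lemma enorm_sqr (x0 : 'cV[R]_n) : enorm x0 ^+ 2 = \sum_i x0 i 0 ^+ 2.
Proof. by rewrite sqr_sqrtr // sumr_ge0 // => i _; exact: sqr_ge0. Qed.

Lemma outer_le (x0 : 'cV[R]_n) i j : `|(x0 *m x0^T) i j| <= enorm x0 ^+ 2.
Proof.
have xi k : `|x0 k 0| <= enorm x0.
  rewrite -(@ler_pXn2r _ 2) ?nnegrE ?sqrtr_ge0 // real_normK ?num_real //.
  rewrite enorm_sqr (bigD1 k) //= lerDl.
  by apply: sumr_ge0 => l _; exact: sqr_ge0.
by rewrite mxE big_ord1 mxE normrM expr2 ler_pM.
Qed.

Lemma two_stable_lyapunov M N Q : posdef Q ->
  (forall v, bil (Q *m M + M^T *m Q + N^T *m Q *m N) v v <= 0) ->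
  two_stable P F w M N.
Proof.
move=> pQ LQ; have [k k0 hk] := quad_le_posdef pQ.
apply: (@two_stable_of_moment_bound _ _ (k * (mxsum Q + 1))).
  by rewrite mulr_ge0 // addr_ge0 // mxsum_ge0.
move=> x0 x sol t e t0 e0.
have mQ := mxsum_ge0 Q; have x2 : 0 <= enorm x0 ^+ 2 by exact: sqr_ge0.
have trQ : \tr (Q *m moment P x t) <= mxsum Q * enorm x0 ^+ 2 + e.
  apply: (lyapunov_bound (moment_initial hF hw sol)
    (fun s G s0 => trace_moment hF hw sol s0) (moment_step hF hw sol)) => //.
    exact: mulr_ge0.
  exact: le_trans (ler_norm _) (trace_abs_le Q (outer_le x0)).
(* k Q dominates the identity. *)
have : \tr ((1%:M - k *: Q) *m moment P x t) <= 0.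
  apply: (trace_moment hF hw sol t0) => v.
  rewrite -/(bil _ _ _) bilDm bilNm bilZm subr_le0.
  have := hk 1%:M 1 v ler01 => /(_ _)/(le_trans (ler_norm _)).
  rewrite mulr1; apply => i j; rewrite mxE.
  by case: eqP => _; rewrite ?normr1 ?normr0.
rewrite mulmxBl mul1mx -scalemxAl linearB linearZ /= subr_le0 => /le_trans; apply.
rewrite -mulrA ler_wpM2l // (le_trans trQ) // mulrDl mul1r mulrDr.
by have := mulr_ge0 mQ (ltW e0); lra.
Qed.

Lemma two_stable_dual_lyapunov M N Q : posdef Q ->
  (forall v, bil (generator M N Q) v v <= 0) -> two_stable P F w M N.
Proof.
move=> pQ LQ; have [k k0 hk] := quad_le_posdef pQ.
have trQ0 : 0 <= \tr Q.
  apply: sumr_ge0 => i _; have := posdef_ge0 pQ (delta_mx i 0).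
  by rewrite /bil trmx_delta -rowE -colE !mxE.
apply: (@two_stable_of_moment_bound _ _ ((k + 1) * \tr Q)).
  by rewrite mulr_ge0 // addr_ge0.
move=> x0 x sol t e t0 e0.
have x2 : 0 <= enorm x0 ^+ 2 by exact: sqr_ge0.
have quadS v : bil (moment P x t) v v <= (k * enorm x0 ^+ 2 + e) * bil Q v v.
  apply: (dual_lyapunov_bound (moment_initial hF hw sol)
    (fun s G s0 => trace_moment hF hw sol s0) (moment_step hF hw sol)) => //.
    exact: mulr_ge0.
  move=> u; apply: le_trans (ler_norm _) (hk _ _ u x2 (outer_le x0)).
have : \tr (moment P x t) <= (k * enorm x0 ^+ 2 + e) * \tr Q.
  rewrite /mxtrace mulr_sumr; apply: ler_sum => i _.
  have := quadS (delta_mx i 0).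
  by rewrite /bil trmx_delta -!rowE -!colE !mxE.
move=> /le_trans; apply; rewrite mulrAC ler_wpM2r // mulrDl mul1r mulrDr.
by have := mulr_ge0 k0 (ltW e0); lra.
Qed.

End Stability.

(** * The Schur complement *)

Section Schur.
Context {R : realType} {n m : nat}.
Variables (A C Q : 'M[R]_n) (B D : 'M[R]_(n, m)) (Y : 'M[R]_(m, n)).
Hypothesis pQ : posdef Q.

(** The block form is tested on the vectors (v, W' v) with W = C + D K; as
    C Q + D Y = W Q, the second component maximises the form for given v. *)
Lemma schur_generator :
  (forall v : 'cV[R]_(n + n), (v^T *m block_mx
      (A *m Q + Q *m A^T + B *m Y + Y^T *m B^T) (C *m Q + D *m Y)
      (Q *m C^T + Y^T *m D^T) (- Q) *m v) 0 0 <= 0) ->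
  forall v, bil (generator (A + B *m (Y *m invmx Q)) (C + D *m (Y *m invmx Q)) Q)
    v v <= 0.
Proof.
have [sQ _] := pQ; have uQ := posdef_unitmx pQ.
move=> H v; set K := Y *m invmx Q.
have KQ : K *m Q = Y by rewrite /K -mulmxA mulVmx ?mulmx1.
have QK : Q *m K^T = Y^T by rewrite -[Q]sQ -trmx_mul KQ.
set W := C + D *m K.
have WQ : C *m Q + D *m Y = W *m Q by rewrite /W mulmxDl -mulmxA KQ.
have QW : Q *m C^T + Y^T *m D^T = Q *m W^T.
  by rewrite /W linearD /= trmx_mul mulmxDr mulmxA QK.
(* The second block column contributes W Q - W Q = 0 on this vector. *)
have := H (col_mx v (W^T *m v)).
rewrite WQ QW tr_col_mx mul_row_block mul_row_col.
rewrite trmx_mul trmxK.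
have -> : generator (A + B *m K) W Q =
    A *m Q + Q *m A^T + B *m Y + Y^T *m B^T + W *m Q *m W^T.
  have -> : A *m Q + Q *m A^T + B *m Y + Y^T *m B^T =
      (A *m Q + B *m Y) + (Q *m A^T + Y^T *m B^T).
    by rewrite -!addrA; congr (_ + _); rewrite addrCA.
  rewrite /generator mulmxDl -mulmxA KQ.
  by rewrite linearD /= trmx_mul mulmxDr mulmxA QK.
rewrite mulmxN -[v^T *m W *m Q]mulmxA subrr mul0mx addr0.
have -> : v^T *m W *m (Q *m W^T) = v^T *m (W *m Q *m W^T) by rewrite !mulmxA.
by rewrite -mulmxDr.
Qed.

End Schur.

Theorem theorem5 (R : realType) (d : measure_display) (T : measurableType d)
    (P : probability T R) (F : R -> set (set T)) (w : R -> T -> R)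
    (hF : filtration P F) (hw : wiener P F w)
    (n m : nat) (A C : 'M[R]_n) (B D : 'M[R]_(n, m)) :
  [\/ exists (K : 'M[R]_(m, n)) (Q : 'M[R]_n), posdef Q /\
        negsemidef (Q *m (A + B *m K) + (A + B *m K)^T *m Q
                    + (C + D *m K)^T *m Q *m (C + D *m K)),
      exists (K : 'M[R]_(m, n)) (Q : 'M[R]_n), posdef Q /\
        negsemidef ((A + B *m K) *m Q + Q *m (A + B *m K)^T
                    + (C + D *m K) *m Q *m (C + D *m K)^T) |
      exists (Q : 'M[R]_n) (Y : 'M[R]_(m, n)), posdef Q /\
        negsemidef (block_mx
          (A *m Q + Q *m A^T + B *m Y + Y^T *m B^T) (C *m Q + D *m Y)
          (Q *m C^T + Y^T *m D^T)                   (- Q))] ->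
  weakly_stabilizable P F w A B C D.
Proof.
case=> [[K [Q [pQ [_ LQ]]]]|[K [Q [pQ [_ LQ]]]]|[Q [Y [pQ [_ LQ]]]]].
- by exists K; exact: (two_stable_lyapunov hF hw pQ LQ).
- by exists K; exact: (two_stable_dual_lyapunov hF hw pQ LQ).
- exists (Y *m invmx Q); apply: (two_stable_dual_lyapunov hF hw pQ).
  exact: schur_generator pQ LQ.
Qed.
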